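(* Let $n\ge 1$ be an integer, let $0<s<1$, and let $u\in C^2(\mathbb R^n)$ be bounded. Let $D=\mathbb R^{n+1}_+:=\mathbb R^n\times(0,+\infty)$, with points written $(x,y)$, $x\in\mathbb R^n$, $y>0$, and identify $\partial D=\mathbb R^n\times\{0\}$ with $\mathbb R^n$. Consider the Dirichlet problem $$\begin{cases}\left(\dfrac{1-2s}{2y}\dfrac{\partial}{\partial y}+\dfrac12\Delta_{x,y}\right)\phi=0 & \text{in } D=\mathbb R^{n+1}_+,\\[2mm] \phi(x,0)=u(x) & \text{for } x\in\mathbb R^n.\end{cases}$$ Then the function $$U(x_0,y_0)=(K_{y_0}*u)(x_0)=\int_{\mathbb R^n}K_{y_0}(x_0-x)\,u(x)\,dx,\qquad x_0\in\mathbb R^n,\ y_0>0,$$ is a solution to this Dirichlet problem, where for $y>0$ and $x\in\mathbb R^n$ $$K_y(x)=C_{n,s}\,\frac{y^{2s}}{(|x|^2+y^2)^{\frac n2+s}},\qquad C_{n,s}:=\frac{1}{\pi^{\frac n2}}\,\frac{\Gamma\left(s+\frac n2\right)}{\Gamma(s)}.$$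
   Context: $\Delta_{x,y}=\sum_{i=1}^n\frac{\partial^2}{\partial x_i^2}+\frac{\partial^2}{\partial y^2}$ is the Laplacian in all $n+1$ variables, and $\Gamma$ is Euler's Gamma function. That $U$ is a solution means that $U$ is $C^2$ in $D$ and satisfies the differential equation pointwise there, and that $U$ extends continuously to $\overline D=\mathbb R^n\times[0,+\infty)$ with boundary values $U(x,0)=u(x)$, i.e. $U(x,y)\to u(\bar x)$ as $(x,y)\to(\bar x,0)$ with $y>0$, for every $\bar x\in\mathbb R^n$. *)

(* Defs.v *)
From HB Require Import structures.
From mathcomp Require Import all_boot all_order all_algebra.
From mathcomp Require Import all_classical all_reals all_analysis.

Set Implicit Arguments.
Unset Strict Implicit.
Unset Printing Implicit Defensive.

Import Order.TTheory GRing.Theory Num.Theory.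
Import numFieldNormedType.Exports.

Local Open Scope classical_set_scope.
Local Open Scope ring_scope.

(* R^n is ['rV[R]_n]. Its sigma-algebra is the one generated by the coordinate
   functions (as the library does for [n.-tuple R]), that is, the Borel one. *)
Definition rV_display : measure_display.
Proof. exact: default_measure_display. Qed.

Section measurable_rV.
Context {R : realType} {n : nat}.

Definition rV_coord (i : 'I_n) (x : 'rV[R]_n) : measurableTypeR R := x 0 i.

Let rV_set0 : g_sigma_preimage rV_coord set0.
Proof. exact: sigma_algebra0. Qed.

Let rV_setC A : g_sigma_preimage rV_coord A -> g_sigma_preimage rV_coord (~` A).
Proof. exact: sigma_algebraC. Qed.

Let rV_bigcup (F : _^nat) : (forall i, g_sigma_preimage rV_coord (F i)) ->
  g_sigma_preimage rV_coord (\bigcup_i (F i)).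
Proof. exact: sigma_algebra_bigcup. Qed.

HB.instance Definition _ := @isMeasurable.Build rV_display
  'rV[R]_n (g_sigma_preimage rV_coord) rV_set0 rV_setC rV_bigcup.

End measurable_rV.

Section lebesgue_rV.
Context {R : realType}.

Lemma measurable_rV_coord n (i : 'I_n) :
  measurable_fun [set: 'rV[R]_n] (rV_coord i).
Proof.
move=> _ Y mY; rewrite setTI; apply: sub_sigma_algebra => /=.
rewrite -bigcup_seq/=; exists i => /=; first by rewrite mem_index_enum.
by exists Y => //; rewrite setTI.
Qed.

Lemma measurable_fun_rV d (T : measurableType d) n (f : T -> 'rV[R]_n) :
  (forall i, measurable_fun [set: T] (rV_coord i \o f)) ->
  measurable_fun [set: T] f.
Proof.
move=> mf.
have : g_sigma_preimage (fun i => rV_coord i \o f) `<=` measurable.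
  apply: smallest_sub; first exact: sigma_algebra_measurable.
  case: n => [|n] in f mf *; first by rewrite big_ord0.
  rewrite -bigcup_mkord_ord; apply: bigcup_sub => i Ii.
  by move=> A [B mB <-]; exact: mf.
by rewrite g_sigma_preimage_comp => prefS _ A mA; apply: prefS; exists A.
Qed.

Definition rV_cons n (p : 'rV[R]_n * measurableTypeR R) : 'rV[R]_n.+1 :=
  row_mx (p.2 : R)%:M p.1.

Lemma rV_cons0 n p : @rV_cons n p 0 ord0 = p.2.
Proof.
have -> : (ord0 : 'I_n.+1) = lshift n (0 : 'I_1) by exact: val_inj.
by rewrite [LHS](row_mxEl (p.2 : R)%:M) mxE.
Qed.

Lemma rV_consS n p (i : 'I_n) : rV_cons p 0 (lift ord0 i) = p.1 0 i.
Proof.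
have -> : (lift ord0 i : 'I_n.+1) = rshift 1 i by exact: val_inj.
by rewrite [LHS](row_mxEr (p.2 : R)%:M).
Qed.

Lemma measurable_rV_cons n : measurable_fun [set: _] (@rV_cons n).
Proof.
apply: measurable_fun_rV => i; case: (unliftP ord0 i) => [j|] ->.
  rewrite (_ : _ \o _ = rV_coord j \o fst).
    exact: measurableT_comp (measurable_rV_coord j) measurable_fst.
  by apply/funext => p; exact: rV_consS.
rewrite (_ : _ \o _ = snd)//.
by apply/funext => p; exact: rV_cons0.
Qed.

HB.instance Definition _ n :=
  isMeasurableFun.Build _ _ _ _ (@rV_cons n) (@measurable_rV_cons n).

Section product_step.
Variables (n : nat) (mu : {measure set 'rV[R]_n -> \bar R}).

Definition rV_prod : set 'rV[R]_n.+1 -> \bar R :=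
  pushforward (mu \x (@lebesgue_measure R))%E (@rV_cons n).

Let rV_prod0 : rV_prod set0 = 0%E. Proof. exact: measure0. Qed.

Let rV_prod_ge0 A : (0 <= rV_prod A)%E. Proof. exact: measure_ge0. Qed.

Let rV_prod_sigma_additive : semi_sigma_additive rV_prod.
Proof. exact: measure_semi_sigma_additive. Qed.

HB.instance Definition _ := isMeasure.Build _ _ _ rV_prod
  rV_prod0 rV_prod_ge0 rV_prod_sigma_additive.

End product_step.

(* n-dimensional Lebesgue measure: the n-fold product of the Lebesgue measure
   on the line (see [lebesgue_rV_box]). *)
Fixpoint lebesgue_rV n : {measure set 'rV[R]_n -> \bar R} :=
  match n with
  | 0 => dirac (0 : 'rV[R]_0)
  | n'.+1 => rV_prod (lebesgue_rV n')
  end.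

Lemma measurable_rV_box n (A : 'I_n -> set (measurableTypeR R)) :
  (forall i, measurable (A i)) ->
  measurable [set x : 'rV[R]_n | forall i, A i (x 0 i)].
Proof.
move=> mA; rewrite (_ : mkset _ =
    \bigcap_i (if insub i is Some j then rV_coord j @^-1` A j else setT)).
  apply: bigcapT_measurable => k; case: insubP => [j _ _|_] //.
  by rewrite -[X in measurable X]setTI; exact: measurable_rV_coord.
apply/seteqP; split => [x xA i _|x xA i] /=.
  by case: insubP => // j _ _; exact: xA.
by have := xA i I; rewrite valK.
Qed.

Lemma lebesgue_rV_box n (A : 'I_n -> set (measurableTypeR R)) :
  (forall i, measurable (A i)) ->
  lebesgue_rV n [set x | forall i, A i (x 0 i)] =
  (\prod_(i < n) @lebesgue_measure R (A i))%E.
Proof.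
elim: n => [|n IH] in A * => mA.
  rewrite big_ord0 /= diracE (_ : _ \in _ = true)//.
  by apply/mem_set => -[].
rewrite big_ord_recl muleC -IH//= /rV_prod /pushforward.
rewrite -product_measure1E//; last exact: (measurable_rV_box (fun i => mA (lift ord0 i))).
congr (product_measure1 _ _ _).
apply/seteqP; split => [[x t] /= xA|[x t] /= [xA At] i].
  split => [i|].
    by have := xA (lift ord0 i); rewrite rV_consS.
  by have := xA ord0; rewrite rV_cons0.
by case: (unliftP ord0 i) => [j|] ->; rewrite ?rV_consS ?rV_cons0.
Qed.

End lebesgue_rV.

Section Ck.
Context {R : realType}.

Definition partial m (i : 'I_m) (f : 'rV[R]_m -> R) : 'rV[R]_m -> R :=
  'D_(delta_mx 0 i) f.

(* A is meant to be open: derivatives and continuity at the points of A are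
   those of f as a function on the whole space. *)
Fixpoint Ck k m (A : set 'rV[R]_m) (f : 'rV[R]_m -> R) : Prop :=
  (forall x, A x -> {for x, continuous f}) /\
  match k with
  | 0 => True
  | k'.+1 => forall i : 'I_m,
      (forall x, A x -> derivable f x (delta_mx 0 i)) /\ Ck k' A (partial i f)
  end.

Definition laplacian m (f : 'rV[R]_m -> R) (x : 'rV[R]_m) : R :=
  \sum_(i < m) partial i (partial i f) x.

(* The norm of ['rV[R]_m] in the library is the sup norm. *)
Definition enorm m (x : 'rV[R]_m) : R := Num.sqrt (\sum_(i < m) x 0 i ^+ 2).

End Ck.

(* Meaningful for a > 0. *)
Definition Gamma {R : realType} (a : R) : R :=
  \int[@lebesgue_measure R]_(t in `]0%R, +oo[) (t `^ (a - 1) * expR (- t)).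

Section Dirichlet.
Context {R : realType}.
Variable n : nat.

(* R^(n+1) = R^n x R: the coordinate y is the last one. *)
Definition rVpoint (x : 'rV[R]_n) (y : R) : 'rV[R]_(n + 1) := row_mx x y%:M.
Definition xpart (p : 'rV[R]_(n + 1)) : 'rV[R]_n := lsubmx p.
Definition yindex : 'I_(n + 1) := rshift n ord0.
Definition ypart (p : 'rV[R]_(n + 1)) : R := p 0 yindex.

Definition halfspace : set 'rV[R]_(n + 1) := [set p | 0 < ypart p].

Definition dirichlet_solution (s : R) (u : 'rV[R]_n -> R)
    (phi : 'rV[R]_(n + 1) -> R) : Prop :=
  [/\ Ck 2 halfspace phi,
      forall p, halfspace p ->
        (1 - 2 * s) / (2 * ypart p) * partial yindex phi p
          + 1 / 2 * laplacian phi p = 0 &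
      forall xbar : 'rV[R]_n,
        phi p @[p --> within halfspace (nbhs (rVpoint xbar 0))] --> u xbar].

Definition poisson_const (s : R) : R :=
  1 / pi `^ (n%:R / 2) * (Gamma (s + n%:R / 2) / Gamma s).

Definition poisson_kernel (s y : R) (x : 'rV[R]_n) : R :=
  poisson_const s *
  (y `^ (2 * s) / (enorm x ^+ 2 + y ^+ 2) `^ (n%:R / 2 + s)).

Definition poisson_integral (s : R) (u : 'rV[R]_n -> R)
    (p : 'rV[R]_(n + 1)) : R :=
  \int[lebesgue_rV n]_x (poisson_kernel s (ypart p) (xpart p - x) * u x).

End Dirichlet.

(* Main.v *)
Require Import Defs.
From HB Require Import structures.
From mathcomp Require Import all_boot all_order all_algebra.
From mathcomp Require Import all_classical all_reals all_analysis.
From mathcomp Require Import measurable_realfun ring lra.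

Set Implicit Arguments.
Unset Strict Implicit.
Unset Printing Implicit Defensive.

Import Order.TTheory GRing.Theory Num.Theory.
Import numFieldNormedType.Exports.

Local Open Scope classical_set_scope.
Local Open Scope ring_scope.

(** Write xi = p - (x, 0) for p in the half-space and x in R^n, y = ypart p for
the last coordinate of xi, a = 2 s, b = n / 2 + s. Up to a constant, the kernel
is Phi(xi) = y^a / |xi|^(2 b), and three facts have to be established.

Mass one. For rho > 0, Gamma b / rho^b is the integral of t^(b - 1) e^(- rho t)
over t > 0. Taking rho = |xi|^2 and exchanging the integrals leaves a Gaussian
integral in x, equal to (pi / t)^(n / 2), and then the integral defining
Gamma s (integral_rV_kernel). This gives the normalization of the kernel as well
as the integrability in x of |xi|^(- 2 b) at every positive height.

Smoothness and the equation. Every derivative of Phi is Phi times a polynomial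
in 1 / y, 1 / |xi|^2 and the quotients xi_i / |xi|^2. Such a polynomial, called a
multiplier below, is bounded where y stays away from 0, and so are its
derivatives. By the mean value theorem a kernel Phi e, with e a multiplier,
satisfies a Lipschitz estimate and a first-order Taylor estimate whose errors
are constant multiples of |xi|^(- 2 b), with a constant that does not depend on
x (kern_lipschitz, kern_taylor). Integrating them against the bounded function u
shows that the potential of a multiplier is continuous, and differentiable in
every direction with a derivative that is again the potential of a multiplier.
Hence potentials are of class C^k for all k (Ck_potential), and the differential
equation for the Poisson integral is the integral of the pointwise identity
kernel_equation, in which the coefficients of 1 / y^2 and 1 / |xi|^2 vanish.

Boundary values. As the kernel has mass one, U(p) - u(xbar) is the integral of
the kernel against u - u(xbar). Near xbar the second factor is small; away from
xbar the kernel at height y is at most a constant times y^(2 s) times the kernel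
at height 1, which has mass one, so that this part tends to 0 with y
(poisson_integral_boundary). *)

(** * Integrals over the positive half line *)
Section half_line.
Context {R : realType}.
Notation mu := (@lebesgue_measure R).

(** The functions of interest may blow up at 0, whereas the fundamental theorem of
calculus and the substitution rule on a half line need continuity up to the end
point; they are used on [c / (k + 1), +oo[ and passed to the limit by monotone
convergence. The factor c lets two integrals that differ by a change of scale be
exhausted in step. *)
Lemma cvg_integral_itv0y (f : R -> \bar R) (c : R) : 0 < c ->
  measurable_fun `](0 : R), +oo[ f -> (forall x, 0 < x -> (0 <= f x)%E) ->
  (\int[mu]_(x in `[(c * k.+1%:R^-1)%R, +oo[) f x)%E @[k --> \oo] -->
  (\int[mu]_(x in `]0%R, +oo[) f x)%E.
Proof.
move=> c0 mf f0.
have pos k : 0 < c * k.+1%:R^-1 by rewrite mulr_gt0// invr_gt0.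
have sub k : `[c * k.+1%:R^-1, +oo[ `<=` `]0, +oo[.
  by move=> x /=; rewrite !in_itv/= !andbT; apply: lt_le_trans; exact: pos.
have -> : `](0 : R), +oo[%classic = \bigcup_k `[(c * k.+1%:R^-1), +oo[%classic.
  apply/seteqP; split => [x|x [k _ /sub//]].
  rewrite /= in_itv/= andbT => x0.
  have : `]0, +oo[%classic (x / c).
    by rewrite /= in_itv/= andbT divr_gt0.
  rewrite itvoyEbigcup => -[k _]/=.
  rewrite !in_itv/= !andbT add0r => kx; exists k => //=.
  by rewrite in_itv/= andbT mulrC -ler_pdivlMr.
apply: ge0_nondecreasing_set_cvg_integral => //.
- move=> i j ij; rewrite subsetEset => x /=; rewrite !in_itv/= !andbT.
  apply: le_trans; rewrite ler_pM2l// lef_pV2 ?posrE// ler_nat//.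
- by move=> i; apply: measurable_funS mf.
- by move=> i x /sub; rewrite /= in_itv/= andbT; exact: f0.
Qed.

Lemma measurable_EFin_itv0y (H : R -> R) :
  (forall x, 0 < x -> {for x, continuous H}) ->
  measurable_fun `](0 : R), +oo[ (EFin \o H).
Proof.
move=> cH; apply/measurable_EFinP; apply: open_continuous_measurable_fun => //.
by move=> x; rewrite inE/= in_itv/= andbT; exact: cH.
Qed.

Lemma integral_scale_itv0y (G : R -> R) (c : R) : 0 < c ->
  (forall x, 0 < x -> 0 <= G x) ->
  (forall x, 0 < x -> {for x, continuous G}) ->
  (\int[mu]_(x in `]0%R, +oo[) (G x)%:E =
   \int[mu]_(x in `]0%R, +oo[) (c * G (c * x))%:E)%E.
Proof.
move=> c0 G0 cG.
have cGc x : 0 < x -> {for x, continuous (fun x => c * G (c * x))}.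
  move=> x0; apply: cvgM; first exact: cvg_cst.
  apply: (@continuous_comp _ _ _ (fun x => c * x) G); first exact: mulrl_continuous.
  by apply: cG; rewrite mulr_gt0.
have L : (\int[mu]_(x in `[(c * k.+1%:R^-1)%R, +oo[) (G x)%:E)%E @[k --> \oo] -->
    (\int[mu]_(x in `]0%R, +oo[) (G x)%:E)%E.
  by apply: cvg_integral_itv0y => //; exact: measurable_EFin_itv0y.
have M : (\int[mu]_(x in `[(1 * k.+1%:R^-1)%R, +oo[) (c * G (c * x))%:E)%E
    @[k --> \oo] --> (\int[mu]_(x in `]0%R, +oo[) (c * G (c * x))%:E)%E.
  apply: cvg_integral_itv0y => //; first exact: measurable_EFin_itv0y.
  by move=> x x0; rewrite lee_fin; apply: mulr_ge0; [exact: ltW|apply: G0; exact: mulr_gt0].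
apply: (cvg_unique _ L) => //; apply: cvg_trans M.
apply: near_eq_cvg; near=> k.
rewrite mul1r; set e : R := k.+1%:R^-1.
have e0 : 0 < e by rewrite invr_gt0.
have dF : derive1 (fun x : R => c * x) = cst c.
  apply/funext => x; rewrite derive1E.
  by rewrite deriveM// derive_cst derive_id scaler0 addr0 /GRing.scale/= mulr1.
rewrite (@increasing_ge0_integration_by_substitutiony _ (fun x : R => c * x)).
- by apply: eq_integral => x _; rewrite dF /= mulrC.
- by move=> x y _ _; rewrite ltr_pM2l.
- by rewrite dF => x _; exact: cvg_cst.
- by rewrite dF; apply: is_cvg_cst.
- by rewrite dF; apply: is_cvg_cst.
- split; first by move=> x _; exact: derivableM.
  by apply: cvg_at_right_filter; exact: mulrl_continuous.
- exact: gt0_cvgMry.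
- apply/continuous_within_itvcyP; split.
    move=> x; rewrite in_itv/= andbT => xe; apply: cG.
    by apply: lt_trans xe; rewrite mulr_gt0.
  by apply: cvg_at_right_filter; apply: cG; rewrite mulr_gt0.
- move=> x; rewrite in_itv/= andbT => xe; apply: G0.
  by apply: lt_trans xe; rewrite mulr_gt0.
Unshelve. all: end_near. Qed.

End half_line.

(** * Derivatives of pointwise expressions in one variable *)
Section derive_rules.
Context {R : realType}.
Implicit Types (f g : R -> R) (t a b : R).

Lemma is_derive_add f g t a b : is_derive t 1 f a -> is_derive t 1 g b ->
  is_derive t 1 (fun x => f x + g x) (a + b).
Proof. exact: is_deriveD. Qed.

Lemma is_derive_mul f g t a b : is_derive t 1 f a -> is_derive t 1 g b ->
  is_derive t 1 (fun x => f x * g x) (a * g t + f t * b).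
Proof.
move=> df dg; have := is_deriveM df dg.
by rewrite /GRing.scale/= addrC [_ * a]mulrC.
Qed.

Lemma is_derive_inv f t a : f t != 0 -> is_derive t 1 f a ->
  is_derive t 1 (fun x => (f x)^-1) (- a / f t ^+ 2).
Proof.
move=> ft df; have := is_deriveV ft df.
by rewrite /GRing.scale/= mulNr mulrC -mulNr.
Qed.

Lemma is_derive_powR f t a c : 0 < f t -> is_derive t 1 f a ->
  is_derive t 1 (fun x => f x `^ c) (c * f t `^ (c - 1) * a).
Proof.
by move=> ft df; exact: (is_derive1_comp (is_derive1_powR c ft) df).
Qed.

End derive_rules.

(** * Finiteness and positivity of the Gamma integral *)
Section Gamma_finite.
Context {R : realType}.
Notation mu := (@lebesgue_measure R).

Lemma powR_continuous_gt0 (a x : R) : 0 < x ->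
  {for x, continuous (fun t => t `^ a)}.
Proof.
move=> x0; apply/differentiable_continuous/derivable1_diffP.
by have [] := is_derive1_powR a x0.
Qed.

Lemma powR_expR_continuous (a b x : R) : 0 < x ->
  {for x, continuous (fun t => t `^ a * expR (- (b * t)))}.
Proof.
move=> x0; apply: cvgM; first exact: powR_continuous_gt0.
apply: (@continuous_comp _ _ _ (fun t : R => - (b * t)) expR).
  by apply: cvgN; exact: mulrl_continuous.
exact: continuous_expR.
Qed.

(** For a > 0, F increases from 0 to 1 on the half line, so its derivative f has
integral at most 1. As f a t = a t^(a - 1) (1 + t)^(- a - 1), it has the singularity of the
Gamma integrand at 0, and it dominates e^(- t) at infinity: it is an explicit
majorant up to a constant. *)
Let F (a t : R) := (1 - (1 + t)^-1) `^ a.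
Let f (a t : R) := a * (1 - (1 + t)^-1) `^ (a - 1) * (1 + t) ^- 2.

Let base_gt0 (t : R) : 0 < t -> 0 < 1 - (1 + t)^-1.
Proof. by move=> t0; rewrite subr_gt0 invf_lt1 ?ltrDl// addr_gt0. Qed.

Let is_derive_F (a t : R) : 0 < t -> is_derive t 1 (F a) (f a t).
Proof.
move=> t0; have t10 : 1 + t != 0 by rewrite gt_eqF// addr_gt0.
have D : is_derive t 1 (fun t : R => 1 - (1 + t)^-1) ((1 + t) ^- 2).
  have dt : is_derive t 1 (fun t : R => 1 + t) 1.
    by rewrite -[1 in X in is_derive _ _ _ X]add0r; exact: is_derive_add.
  have := is_derive_add (is_derive_cst (1 : R) t 1) (is_deriveN (is_derive_inv t10 dt)).
  by rewrite add0r mulNr opprK mul1r.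
exact: (@is_derive_powR _ (fun t : R => 1 - (1 + t)^-1) _ _ a (base_gt0 t0) D).
Qed.

Let f_continuous (a t : R) : 0 < t -> {for t, continuous (f a)}.
Proof.
move=> t0; have t10 : 1 + t != 0 by rewrite gt_eqF// addr_gt0.
have D : {for t, continuous (fun t : R => (1 + t)^-1)}.
  by apply: cvgV => //; apply: cvgD; [exact: cvg_cst|exact: cvg_id].
have D2 : {for t, continuous (fun t : R => (1 + t) ^- 2)}.
  rewrite (_ : (fun t => _) = (fun x : R => (1 + x)^-1 * (1 + x)^-1)).
    exact: (cvgM D D).
  by apply/funext => x; rewrite -expr2 exprVn.
apply: (@cvgM _ _ _ _ _ _ _ _ _ D2).
apply: cvgM; first exact: cvg_cst.
apply: (@continuous_comp _ _ _ (fun t : R => 1 - (1 + t)^-1) (fun t => t `^ (a - 1))).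
  by apply: cvgB; [exact: cvg_cst|exact: D].
exact/powR_continuous_gt0/base_gt0.
Qed.

Let F_cvgy (a : R) : F a t @[t --> +oo] --> (1 : R).
Proof.
have V : (1 + t)^-1 @[t --> +oo] --> (0 : R).
  apply/gtr0_cvgV0.
    by near=> t; apply: addr_gt0 => //; near: t;
      apply: nbhs_pinfty_gt; exact: num_real.
  apply/cvgryPge => A; near=> t.
  by rewrite -lerBlDl; near: t; apply: nbhs_pinfty_ge; exact: num_real.
have E : (1 : R) `^ a = 1 by rewrite powR1.
rewrite -[X in _ --> X]E.
have B : 1 - (1 + t)^-1 @[t --> +oo] --> (1 : R).
  by rewrite -[X in _ --> X]subr0; apply: cvgB => //; exact: cvg_cst.
exact: (continuous_cvg _ (@powR_continuous_gt0 a 1 ltr01) B).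
Unshelve. all: end_near. Qed.

Let f_ge0 (a t : R) : 0 < a -> 0 < t -> 0 <= f a t.
Proof.
move=> a0 t0; rewrite /f mulr_ge0 ?invr_ge0 ?exprn_ge0 ?addr_ge0 ?(ltW t0)//.
by rewrite mulr_ge0 ?powR_ge0 ?ltW.
Qed.

Let integral_f (a e : R) : 0 < a -> 0 < e ->
  (\int[mu]_(t in `[e, +oo[) (f a t)%:E <= 1)%E.
Proof.
move=> a0 e0; have e0' t : e < t -> 0 < t by exact: lt_trans.
rewrite (@ge0_continuous_FTC2y _ _ (F a) _ 1).
- by rewrite -EFinB lee_fin gerBl powR_ge0.
- by move=> x ex; rewrite f_ge0//; exact: lt_le_trans ex.
- apply/continuous_within_itvcyP; split.
    by move=> x; rewrite in_itv/= andbT => xe; apply/f_continuous/e0'.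
  by apply: cvg_at_right_filter; apply: f_continuous.
- exact: F_cvgy.
- by move=> x /e0' /(is_derive_F a)[].
- apply: cvg_at_right_filter; apply/differentiable_continuous/derivable1_diffP.
  by have [] := is_derive_F a e0.
- move=> x; rewrite in_itv/= andbT => /e0' /(is_derive_F a) D.
  by rewrite derive1E; exact: derive_val.
Qed.

Let integral0_f (a : R) : 0 < a ->
  (\int[mu]_(t in `]0%R, +oo[) (f a t)%:E <= 1)%E.
Proof.
move=> a0; apply: (@cvge_le _ \oo); last first.
  apply: (@cvg_integral_itv0y _ (fun t => (f a t)%:E) 1) => //.
    by apply: measurable_EFin_itv0y; exact: f_continuous.
  by move=> x x0; rewrite lee_fin f_ge0.
by near=> k; apply: integral_f => //; rewrite mul1r invr_gt0.
Unshelve. all: end_near. Qed.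

Let gammaf (a t : R) := t `^ (a - 1) * expR (- t).

Let gammaf_continuous (a t : R) : 0 < t -> {for t, continuous (gammaf a)}.
Proof.
move=> t0; have := @powR_expR_continuous (a - 1) 1 t t0.
by rewrite (_ : (fun _ => _) = gammaf a)//; apply/funext => x; rewrite mul1r.
Qed.

Let gammaf_ge0 (a t : R) : 0 <= gammaf a t.
Proof. by rewrite /gammaf mulr_ge0 ?powR_ge0 ?expR_ge0. Qed.

(** This is (1 + t)^(a + 1) <= (a + 1)^(a + 1) e^t, which is the power a + 1 of
(1 + t) / (a + 1) <= 1 + t / (a + 1) <= e^(t / (a + 1)). *)
Let gammaf_le (a t : R) : 0 < a -> 0 < t ->
  gammaf a t <= (a + 1) `^ (a + 1) / a * f a t.
Proof.
move=> a0 t0; have a1 : 0 < a + 1 by rewrite addr_gt0.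
have t1 : 0 < 1 + t by rewrite addr_gt0.
have -> : (a + 1) `^ (a + 1) / a * f a t =
    t `^ (a - 1) * (((a + 1) / (1 + t)) `^ (a + 1)).
  have -> : f a t = a * (t `^ (a - 1) * (1 + t)^-1 `^ (a + 1)).
    rewrite /f -mulrA; congr (_ * _).
    have -> : 1 - (1 + t)^-1 = t * (1 + t)^-1 by field; rewrite gt_eqF.
    rewrite powRM ?invr_ge0 ?(ltW t0) ?(ltW t1)// -mulrA; congr (_ * _).
    rewrite -exprVn -powR_mulrn ?invr_ge0 ?(ltW t1)// -powRD.
      by congr (_ `^ _); rewrite -natr1; ring.
    by rewrite invr_eq0 (gt_eqF t1) implybT.
  rewrite powRM ?invr_ge0 ?(ltW a1) ?(ltW t1)//; field.
  by rewrite gt_eqF.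
rewrite /gammaf ler_wpM2l ?powR_ge0// expRN.
rewrite -(ler_pM2l (expR_gt0 t)) mulfV ?gt_eqF ?expR_gt0//.
have -> : expR t = expR (t / (a + 1)) `^ (a + 1).
  by rewrite -expRM divfK// gt_eqF.
rewrite -powRM ?expR_ge0 ?divr_ge0 ?(ltW a1) ?(ltW t1)//.
have E : (1 : R) `^ (a + 1) = 1 by rewrite powR1.
rewrite -[leLHS]E; apply: ge0_ler_powR; rewrite ?nnegrE ?(ltW a1)//.
  by rewrite mulr_ge0 ?expR_ge0 ?divr_ge0 ?(ltW a1) ?(ltW t1).
apply: (@le_trans _ _ ((1 + t / (a + 1)) * ((a + 1) / (1 + t)))); last first.
  by rewrite ler_wpM2r ?expR_ge1Dx ?divr_ge0 ?(ltW a1) ?(ltW t1).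
rewrite (_ : _ * _ = 1 + a / (1 + t)); last by field; rewrite !gt_eqF.
by rewrite lerDl divr_ge0 ?ltW.
Qed.

(** Gamma a is the finite part of an extended real integral; since the integral is
finite, no information is lost, and Gamma can be used in Tonelli's theorem. *)
Lemma Gamma_itv0y (a : R) : 0 < a ->
  (\int[mu]_(t in `]0%R, +oo[) (t `^ (a - 1) * expR (- t))%:E = (Gamma a)%:E)%E.
Proof.
move=> a0; rewrite /Gamma /Rintegral fineK// ge0_fin_numE; last first.
  by apply: integral_ge0 => t _; rewrite lee_fin gammaf_ge0.
pose C := (a + 1) `^ (a + 1) / a.
have C0 : 0 <= C by rewrite divr_ge0 ?powR_ge0 ?ltW.
have mf : measurable_fun `](0 : R), +oo[ (EFin \o f a).
  by apply: measurable_EFin_itv0y; exact: f_continuous.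
have f0 t : `](0 : R), +oo[%classic t -> (0 <= (f a t)%:E)%E.
  by rewrite /= in_itv/= andbT lee_fin; exact: f_ge0.
apply: (@le_lt_trans _ _ (C%:E * \int[mu]_(t in `]0%R, +oo[) (f a t)%:E)%E).
  rewrite -ge0_integralZl//.
  apply: ge0_le_integral => //.
  - by move=> t _; rewrite lee_fin gammaf_ge0.
  - by apply: measurable_EFin_itv0y => t; exact: gammaf_continuous.
  - apply: (@measurable_EFin_itv0y _ (fun t => C * f a t)) => t t0.
    by apply: cvgM; [exact: cvg_cst|exact: f_continuous].
  - move=> t; rewrite /= in_itv/= andbT -EFinM lee_fin; exact: gammaf_le.
apply: (@le_lt_trans _ _ (C%:E * 1)%E); last by rewrite mule1 ltry.
by rewrite lee_pmul2l ?integral0_f// ?lte_fin// divr_gt0// powR_gt0// addr_gt0.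
Qed.

(** On [1, 2] the integrand is at least e^(- 2) / 2, because t^(a - 1) >= 1 / t. *)
Lemma Gamma_gt0 (a : R) : 0 < a -> 0 < Gamma a.
Proof.
move=> a0; rewrite -lte_fin -Gamma_itv0y//.
have c0 : 0 < 2^-1 * expR (- 2) :> R by rewrite mulr_gt0 ?expR_gt0 ?invr_gt0.
apply: (@lt_le_trans _ _ (\int[mu]_(t in `[1%R, 2%R]) (2^-1 * expR (- 2))%:E)%E).
  rewrite integral_cst// [X in (_ * X)%E]lebesgue_measure_itv/= lte_fin ltr1n.
  by rewrite -EFinB -EFinM lte_fin mulr_gt0// subr_gt0 ltr1n.
have sub : `[(1 : R), 2] `<=` `]0, +oo[.
  by move=> x /=; rewrite !in_itv/= andbT => /andP[+ _]; exact: lt_le_trans.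
have mg : measurable_fun `](0 : R), +oo[ (EFin \o gammaf a).
  by apply: measurable_EFin_itv0y => t; exact: gammaf_continuous.
apply: (@le_trans _ _ (\int[mu]_(t in `[1%R, 2%R]) (gammaf a t)%:E)%E).
  apply: ge0_le_integral => //.
  - by apply: measurable_funS mg.
  - move=> x /=; rewrite in_itv/= lee_fin => /andP[x1 x2].
    have x0 : 0 < x by exact: lt_le_trans x1.
    rewrite /gammaf ler_pM ?expR_ge0 ?invr_ge0 ?ler_expR ?lerN2//.
    apply: (@le_trans _ _ (x `^ (- 1))); first by rewrite powR_inv1 ?(ltW x0)// lef_pV2 ?posrE.
    by rewrite ler_powR// lerDr ltW.
apply: ge0_subset_integral => //.
by move=> x _; rewrite lee_fin gammaf_ge0.
Qed.

End Gamma_finite.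

(** * Lebesgue measure and Borel sets in several dimensions *)
Section lebesgue_rV_theory.
Context {R : realType}.
Notation mu := (@lebesgue_measure R).

(** The cubes [-k, k]^n exhaust the space. *)
Lemma sigma_finite_lebesgue_rV n : sigma_finite setT (@lebesgue_rV R n).
Proof.
pose A (k : nat) : set (measurableTypeR R) := `[(- k%:R)%R, k%:R]%classic.
have mA k : measurable (A k) by exact: measurable_itv.
exists (fun k => [set x : 'rV[R]_n | forall i, A k (x 0 i)]).
  apply/esym; rewrite -subTset => x _.
  have [k xk] : exists k : nat, forall i, `|x 0 i| <= k%:R.
    exists (Num.bound (\sum_i `|x 0 i|)) => i.
    apply: (@le_trans _ _ (\sum_i `|x 0 i|)).
      by rewrite (bigD1 i)//= lerDl sumr_ge0.
    by apply: ltW; apply: archi_boundP; apply: sumr_ge0.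
  by exists k => // i; rewrite /A/= in_itv/= -ler_norml.
move=> k; split; first exact: (@measurable_rV_box _ _ (fun=> A k)).
rewrite (@lebesgue_rV_box _ _ (fun=> A k))//.
rewrite ltey_eq prode_fin_num// => i _.
by rewrite lebesgue_measure_itv/=; case: ifPn.
Qed.

(** The same set function as lebesgue_rV n, under a name to which the structure of
sigma-finite measure required by Tonelli's theorem can be attached; the two are
convertible. *)
Definition lebesgue_rV_sf n (A : set 'rV[R]_n) : \bar R := lebesgue_rV n A.

HB.instance Definition _ n := isMeasure.Build _ _ _ (@lebesgue_rV_sf n)
  (measure0 (@lebesgue_rV R n)) (measure_ge0 (@lebesgue_rV R n))
  (@measure_semi_sigma_additive _ _ _ (@lebesgue_rV R n)).

HB.instance Definition _ n := Measure_isSigmaFinite.Build _ _ _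
  (@lebesgue_rV_sf n) (@sigma_finite_lebesgue_rV n).

(** The measurable sets are generated by the coordinates, and the topology comes
from the sup norm, whose balls are boxes: an open set is the union of the
countably many boxes with rational centre and radius 1 / (k + 1) that it
contains. *)
Lemma open_rV_measurable n (U : set 'rV[R]_n) : open U -> measurable U.
Proof.
move=> oU.
pose box (q : 'rV[rat]_n * nat) := [set x : 'rV[R]_n |
  forall i, `](ratr (q.1 0 i) - q.2.+1%:R^-1), (ratr (q.1 0 i) + q.2.+1%:R^-1)[%classic (x 0 i)].
have mbox q : measurable (box q).
  apply: (@measurable_rV_box _ _ (fun i => `](ratr (q.1 0 i) - q.2.+1%:R^-1),
    (ratr (q.1 0 i) + q.2.+1%:R^-1)[%classic)) => i; exact: measurable_itv.
pose B q := if pselect (box q `<=` U) then box q else set0.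
have -> : U = \bigcup_q B q.
  apply/seteqP; split => [x Ux|x [q _]]; last first.
    by rewrite /B; case: pselect => // qU; exact: qU.
  have /nbhs_ballP[e /= e0 eU] := oU _ Ux.
  have [k ke] : exists k, k.+1%:R^-1 < e / 2.
    exists (Num.bound (e / 2)^-1).
    rewrite -[ltRHS]invrK ltf_pV2 ?posrE ?invr_gt0 ?divr_gt0//.
    apply: (@lt_trans _ _ (Num.bound (e / 2)^-1)%:R); last by rewrite ltr_nat.
    by apply: archi_boundP; rewrite invr_ge0 divr_ge0 ?ltW.
  (* d is an opaque name for the radius, for the sake of linear arithmetic. *)
  have [d dE] : exists d : R, d = k.+1%:R^-1 by exists k.+1%:R^-1.
  have d0 : 0 < d by rewrite dE invr_gt0.
  rewrite -dE in ke.
  have qe (i : 'I_n) : exists r : rat, ratr r \in `](x 0 i - d), (x 0 i + d)[.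
    by apply: rat_in_itvoo; lra.
  have [q qP] := choice qe.
  have xq : box (\row_i q i, k) x.
    by move=> i /=; have := qP i; rewrite !mxE -dE !in_itv/=; lra.
  exists (\row_i q i, k) => //; rewrite /B; case: pselect => // -[] y yq.
  apply: eU; split; first by exact: e0.
  move=> i j; rewrite (ord1 i) /ball/=.
  have := yq j; have := xq j; rewrite /= !mxE -dE !in_itv/= ltr_norml; lra.
apply: countable_bigcupT_measurable => // q.
by rewrite /B; case: pselect => ?; [exact: mbox|exact: measurable0].
Qed.

Lemma continuous_rV_measurable n (f : 'rV[R]_n -> R) :
  continuous f -> measurable_fun setT f.
Proof.
move=> /continuousP cf; apply: (measurability _ (RGenOpens.measurableE R)).
move=> _ [_ [a [b ->] <-]]; rewrite setTI; apply: open_rV_measurable.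
exact/cf/interval_open.
Qed.

Definition sqnorm m (x : 'rV[R]_m) : R := \sum_i x 0 i ^+ 2.

Lemma measurable_sqnormB m (X : 'rV[R]_m) :
  measurable_fun setT (fun x : 'rV[R]_m => sqnorm (X - x)).
Proof.
apply: measurable_sum => i; apply: measurable_funX.
rewrite (_ : (fun _ => _) = (fun x => X 0 i - rV_coord i x)).
  by apply: measurable_funB => //; exact: measurable_rV_coord.
by apply/funext => x; rewrite !mxE.
Qed.

(** The integrand is proportional to the normal density of mean m and variance
1 / (2 t). *)
Lemma integral_gauss_line (t m : R) : 0 < t ->
  (\int[mu]_y (expR (- (t * (m - y) ^+ 2)))%:E = (Num.sqrt (pi / t))%:E)%E.
Proof.
move=> t0; pose s := Num.sqrt ((2 * t)^-1).
have s2 : s ^+ 2 = (2 * t)^-1 by rewrite sqr_sqrtr ?invr_ge0 ?mulr_ge0 ?ltW.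
have s0 : s != 0 by rewrite sqrtr_eq0 -ltNge invr_gt0 mulr_gt0.
have pE : normal_peak s = (Num.sqrt (pi / t))^-1.
  rewrite /normal_peak s2; congr (Num.sqrt _)^-1.
  by rewrite -mulr_natr; field; rewrite gt_eqF.
have p0 : 0 < Num.sqrt (pi / t) by rewrite sqrtr_gt0 divr_gt0 ?pi_gt0.
have E : (fun y : R => (expR (- (t * (m - y) ^+ 2)))%:E) = EFin \o normal_fun m s.
  apply/funext => y /=; rewrite /normal_fun s2; congr (expR _)%:E.
  by rewrite -mulr_natr; field; rewrite gt_eqF.
have /esym := integral_normal_pdf m s.
rewrite normal_pdfE// pE.
under eq_integral do rewrite EFinM.
rewrite ge0_integralZl//; last 2 first.
- by apply/measurable_EFinP; exact: measurable_normal_fun.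
- by move=> y _; rewrite lee_fin; exact: normal_fun_ge0.
rewrite E => /(congr1 (fun z => (Num.sqrt (pi / t))%:E * z)%E).
by rewrite mule1 muleA -EFinM mulfV ?gt_eqF// mul1e.
Qed.

End lebesgue_rV_theory.

(** * Gaussian integrals in several dimensions *)
Section gauss_rV.
Context {R : realType}.
Notation mu := (@lebesgue_measure R).

Lemma sqnormS m (x : 'rV[R]_m.+1) :
  sqnorm x = x 0 ord0 ^+ 2 + sqnorm (\row_i x 0 (lift ord0 i)).
Proof.
by rewrite /sqnorm big_ord_recl; congr (_ + _); apply: eq_bigr => i _; rewrite !mxE.
Qed.

(** The Gaussian is a product of functions of one coordinate, and the measure on
R^(m + 1) is the image of the product of the measure on R^m and the line. *)
Lemma integral_gauss_rV m (t : R) (X : 'rV[R]_m) : 0 < t ->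
  (\int[lebesgue_rV m]_x (expR (- (t * sqnorm (X - x))))%:E =
   (Num.sqrt (pi / t) ^+ m)%:E)%E.
Proof.
move=> t0.
have mf k (Y : 'rV[R]_k) :
    measurable_fun setT (fun x : 'rV[R]_k => (expR (- (t * sqnorm (Y - x))))%:E).
  apply/measurable_EFinP; apply: measurableT_comp => //.
  apply: measurableT_comp => //; apply: measurable_funM => //.
  exact: measurable_sqnormB.
elim: m X => [|m IH] X.
  rewrite /= integral_dirac; [|by []|exact: mf].
  by rewrite diracT mul1e /sqnorm big_ord0 mulr0 oppr0 expR0.
rewrite /= (ge0_integral_pushforward (@measurable_rV_cons R m)); last 3 first.
- by [].
- exact: mf.
- by move=> x _; rewrite lee_fin expR_ge0.
pose f (p : 'rV[R]_m * measurableTypeR R) : \bar R :=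
  (expR (- (t * sqnorm (X - rV_cons p))))%:E.
have fE x y : f (x, y) = ((expR (- (t * sqnorm (\row_i X 0 (lift ord0 i) - x))))%:E *
    (expR (- (t * (X 0 ord0 - y) ^+ 2)))%:E)%E.
  rewrite -EFinM -expRD; congr (expR _)%:E.
  rewrite sqnormS addrC mulrDr opprD; congr (- (t * sqnorm _) - t * _ ^+ 2).
    by apply/rowP => i; rewrite mxE 2!mxE rV_consS 3!mxE.
  by rewrite 2!mxE rV_cons0.
have mff : measurable_fun setT f.
  exact: (measurableT_comp (mf _ _) (@measurable_rV_cons R m)).
rewrite preimage_setT.
transitivity (\int[(lebesgue_rV m \x mu)%E]_p f p)%E; first by [].
transitivity (\int[@lebesgue_rV_sf R m]_x \int[mu]_y f (x, y))%E.
  rewrite -(@fubini_tonelli1 _ _ _ _ _ (@lebesgue_rV_sf R m) mu f)//.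
  by move=> p; rewrite lee_fin expR_ge0.
under eq_integral => x _.
  under eq_integral do rewrite fE.
  rewrite ge0_integralZl//; last first.
    apply/measurable_EFinP; apply: measurableT_comp => //.
    apply: measurableT_comp => //; apply: measurable_funM => //.
    by apply: measurable_funX; exact: measurable_funB.
  rewrite integral_gauss_line//.
  over.
rewrite ge0_integralZr//; last exact: mf.
by rewrite IH// -EFinM exprSr.
Qed.

End gauss_rV.

(** * The mass of the kernel *)
Section kernel_mass.
Context {R : realType}.
Notation mu := (@lebesgue_measure R).

Lemma Gamma_scale (b c : R) : 0 < b -> 0 < c ->
  (\int[mu]_(t in `]0%R, +oo[) (t `^ (b - 1) * expR (- (c * t)))%:E =
   (Gamma b / c `^ b)%:E)%E.
Proof.
move=> b0 c0; have cb0 : 0 < c `^ b by exact: powR_gt0.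
have cbE : c `^ b = c * c `^ (b - 1).
  rewrite -[in LHS](subrK 1 b) [LHS]powRD ?(gt_eqF c0) ?implybT//.
  by rewrite powRr1 ?(ltW c0)// mulrC.
have := Gamma_itv0y b0.
rewrite (@integral_scale_itv0y _ (fun t => t `^ (b - 1) * expR (- t)) c)//; last 2 first.
- by move=> x _; rewrite mulr_ge0 ?powR_ge0 ?expR_ge0.
- move=> x x0; have := @powR_expR_continuous R (b - 1) 1 x x0.
  rewrite (_ : (fun _ => _) = (fun t : R => t `^ (b - 1) * expR (- t)))//.
  by apply/funext => t; rewrite mul1r.
have E t : `](0 : R), +oo[%classic t -> (c * ((c * t) `^ (b - 1) * expR (- (c * t))))%:E =
    ((c `^ b)%:E * (t `^ (b - 1) * expR (- (c * t)))%:E)%E.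
  rewrite /= in_itv/= andbT => t0; rewrite -EFinM powRM ?(ltW c0) ?(ltW t0)//.
  by rewrite cbE; congr EFin; ring.
have -> : (\int[mu]_(t in `]0%R, +oo[) (c * ((c * t) `^ (b - 1) * expR (- (c * t))))%:E =
    \int[mu]_(t in `]0%R, +oo[) ((c `^ b)%:E * (t `^ (b - 1) * expR (- (c * t)))%:E))%E.
  by apply: eq_integral => t /set_mem/E.
rewrite ge0_integralZl//; last 3 first.
- by apply: measurable_EFin_itv0y => t; exact: powR_expR_continuous.
- by move=> t _; rewrite lee_fin mulr_ge0 ?powR_ge0 ?expR_ge0.
- by rewrite lee_fin ltW.
move=> /(congr1 (fun z => ((c `^ b)^-1)%:E * z)%E).
by rewrite muleA -!EFinM mulVf ?gt_eqF// mul1e mulrC.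
Qed.

(** With rho = |X - x|^2 + y^2, write Gamma b / rho^b as the integral of
t^(b - 1) e^(- rho t) and exchange the integrals. The integral over x is Gaussian
and turns the exponent b - 1 into b - 1 - n / 2 = s - 1, so that Gamma s appears
in the remaining integral over t. *)
Lemma integral_rV_kernel n (s y : R) (X : 'rV[R]_n) : 0 < s -> 0 < y ->
  (\int[lebesgue_rV n]_x (((sqnorm (X - x) + y ^+ 2) `^ (n%:R / 2 + s))^-1)%:E =
   (pi `^ (n%:R / 2) * (Gamma s / Gamma (s + n%:R / 2)) / y `^ (2 * s))%:E)%E.
Proof.
move=> s0 y0; set b := n%:R / 2 + s.
have b0 : 0 < b by rewrite ltr_wpDl// divr_ge0.
have G0 := Gamma_gt0 b0.
pose rho x := sqnorm (X - x) + y ^+ 2.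
have rho0 x : 0 < rho x.
  by rewrite ltr_wpDl ?exprn_gt0// sumr_ge0// => i _; rewrite sqr_ge0.
(* The indicator function makes the half line t > 0 a whole-line integral. *)
pose f (p : 'rV[R]_n * measurableTypeR R) : \bar R :=
  (p.2 `^ (b - 1) * expR (- (rho p.1 * p.2)) * \1_(`](0 : R), +oo[) p.2)%:E.
have f0 p : (0 <= f p)%E by rewrite lee_fin !mulr_ge0 ?powR_ge0 ?expR_ge0.
have mrho : measurable_fun setT rho.
  by apply: measurable_funD => //; exact: measurable_sqnormB.
have mf : measurable_fun setT f.
  apply/measurable_EFinP; apply: measurable_funM; last first.
    by apply: measurableT_comp => //; exact: measurable_indic.
  apply: measurable_funM.
    exact: (measurableT_comp (measurable_powR _) measurable_snd).
  apply: measurableT_comp => //; apply: measurableT_comp => //.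
  by apply: measurable_funM => //; exact: (measurableT_comp mrho measurable_fst).
have fx x : (\int[mu]_t f (x, t) = (Gamma b)%:E * ((rho x `^ b)^-1)%:E)%E.
  rewrite -EFinM -Gamma_scale// [RHS]integral_mkcond; apply: eq_integral => t _.
  rewrite /f patchE/= indicE; case: ifPn => _; first by rewrite mulr1.
  by rewrite mulr0.
pose g (t : R) : \bar R := (t `^ (s - 1) * expR (- (y ^+ 2 * t)))%:E.
have g0 t : (0 <= g t)%E by rewrite lee_fin mulr_ge0 ?powR_ge0 ?expR_ge0.
have mg : measurable_fun `](0 : R), +oo[ g.
  apply: (@measurable_EFin_itv0y _ (fun t => t `^ (s - 1) * expR (- (y ^+ 2 * t)))).
  by move=> t; exact: powR_expR_continuous.
have sqrtX (a : R) : 0 <= a -> Num.sqrt a ^+ n = a `^ (n%:R / 2).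
  move=> a0; rewrite -powR_mulrn ?sqrtr_ge0// -powR12_sqrt// -powRrM.
  by congr (_ `^ _); rewrite mulrC.
have ft t : (\int[lebesgue_rV n]_x f (x, t) = (pi `^ (n%:R / 2))%:E *
    (g \_ [set` `](0%R : R), +oo[]) t)%E.
  rewrite patchE /f/= indicE; case: ifPn => [|_]; last first.
    by rewrite mule0; apply: integral0_eq => x _; rewrite mulr0.
  rewrite inE/= in_itv/= andbT => t0.
  transitivity (\int[lebesgue_rV n]_x ((t `^ (b - 1) * expR (- (y ^+ 2 * t)))%:E *
      (expR (- (t * sqnorm (X - x))))%:E))%E.
    apply: eq_integral => x _; rewrite -EFinM mulr1 -mulrA -expRD.
    by congr (_ * expR _)%:E; rewrite /rho; ring.
  rewrite ge0_integralZl//; last 2 first.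
  - apply/measurable_EFinP; apply: measurableT_comp => //.
    apply: measurableT_comp => //; apply: measurable_funM => //.
    exact: measurable_sqnormB.
  - by rewrite lee_fin mulr_ge0 ?powR_ge0 ?expR_ge0.
  rewrite integral_gauss_rV// sqrtX ?divr_ge0 ?pi_ge0 ?(ltW t0)//.
  rewrite powRM ?pi_ge0 ?invr_ge0 ?(ltW t0)// -!EFinM; congr EFin.
  have -> : t `^ (s - 1) = t `^ (b - 1) * t^-1 `^ (n%:R / 2).
    rewrite -powR_inv1 ?(ltW t0)// -powRrM -powRD ?(gt_eqF t0) ?implybT//.
    by congr (_ `^ _); rewrite /b; ring.
  ring.
have := @fubini_tonelli _ _ _ _ _ (@lebesgue_rV_sf R n) mu f mf f0.
under eq_integral do rewrite fx.
rewrite ge0_integralZl//; last 3 first.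
- apply/measurable_EFinP.
  rewrite (_ : (fun _ => _) = (fun x => rho x `^ (- b))).
    exact: (measurableT_comp (measurable_powR _) mrho).
  by apply/funext => x; rewrite powRN.
- by move=> x _; rewrite lee_fin invr_ge0 powR_ge0.
- by rewrite lee_fin ltW.
under [in RHS]eq_integral => t _ do rewrite ft.
rewrite ge0_integralZl//; last 3 first.
- exact/(measurable_restrictT _ _).1.
- by move=> t _; rewrite patchE; case: ifP.
- by rewrite lee_fin powR_ge0.
rewrite -integral_mkcond Gamma_scale ?exprn_gt0//.
move=> /(congr1 (fun z => ((Gamma b)^-1)%:E * z)%E).
rewrite muleA -EFinM mulVf ?gt_eqF// mul1e => ->.
rewrite -!EFinM; congr EFin.
rewrite -[y ^+ 2]powR_mulrn ?(ltW y0)// -powRrM [s + _]addrC -/b.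
ring.
Qed.

End kernel_mass.

(** * Multipliers and their directional derivatives *)
Section multipliers.
Context {R : realType} (m : nat) (k : 'I_m).
Implicit Types (v w xi : 'rV[R]_m).

Definition dot v w : R := \sum_i v 0 i * w 0 i.
Definition norm1 v : R := \sum_i `|v 0 i|.

(** Polynomial expressions in 1 / y, 1 / |xi|^2 and <w, xi> / |xi|^2, where y is the
coordinate of index k. Syntax, rather than functions, lets the derivative be an
operation on expressions, so that every estimate is proved once by induction and
applies to derivatives of all orders. *)
Inductive multiplier : Type :=
| Cst of R
| Yinv
| Rinv
| Slope of 'rV[R]_m
| Add of multiplier & multiplier
| Mul of multiplier & multiplier.

Fixpoint ev (e : multiplier) xi : R :=
  match e with
  | Cst c => c
  | Yinv => (xi 0 k)^-1
  | Rinv => (sqnorm xi)^-1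
  | Slope w => dot w xi * (sqnorm xi)^-1
  | Add e1 e2 => ev e1 xi + ev e2 xi
  | Mul e1 e2 => ev e1 xi * ev e2 xi
  end.

(** The derivative in the direction v; see is_derive_ev. *)
Fixpoint dmult v (e : multiplier) : multiplier :=
  match e with
  | Cst _ => Cst 0
  | Yinv => Mul (Cst (- v 0 k)) (Mul Yinv Yinv)
  | Rinv => Mul (Cst (- 2)) (Mul Rinv (Slope v))
  | Slope w => Add (Mul (Cst (dot w v)) Rinv)
                   (Mul (Cst (- 2)) (Mul (Slope w) (Slope v)))
  | Add e1 e2 => Add (dmult v e1) (dmult v e2)
  | Mul e1 e2 => Add (Mul (dmult v e1) e2) (Mul e1 (dmult v e2))
  end.

Lemma sqnorm_ge0 xi : 0 <= sqnorm xi.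
Proof. by apply: sumr_ge0 => i _; rewrite sqr_ge0. Qed.

Lemma sqr_coord_le_sqnorm xi i : xi 0 i ^+ 2 <= sqnorm xi.
Proof.
by rewrite /sqnorm (bigD1 i)//= lerDl sumr_ge0// => j _; rewrite sqr_ge0.
Qed.

Lemma sqnorm_gt0 xi : 0 < xi 0 k -> 0 < sqnorm xi.
Proof. by move=> x0; rewrite (lt_le_trans _ (sqr_coord_le_sqnorm xi k))// exprn_gt0. Qed.

Lemma dotC v w : dot v w = dot w v.
Proof. by apply: eq_bigr => i _; rewrite mulrC. Qed.

Lemma dotZl c v w : dot (c *: v) w = c * dot v w.
Proof. by rewrite /dot mulr_sumr; apply: eq_bigr => i _; rewrite mxE mulrA. Qed.

Lemma norm1_ge0 v : 0 <= norm1 v.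
Proof. exact: sumr_ge0. Qed.

Lemma coord_le_norm1 v i : `|v 0 i| <= norm1 v.
Proof. by rewrite /norm1 (bigD1 i)//= lerDl sumr_ge0. Qed.

Lemma norm1Z c v : norm1 (c *: v) = `|c| * norm1 v.
Proof. by rewrite mulr_sumr; apply: eq_bigr => i _; rewrite mxE normrM. Qed.

Section line.
Variables (xi v : 'rV[R]_m).
Let line (t : R) := xi + t *: v.

Lemma is_derive_coord_line i (t : R) :
  is_derive t 1 (fun t => line t 0 i) (v 0 i).
Proof.
rewrite (_ : (fun _ => _) = (fun t : R => xi 0 i + t * v 0 i)); last first.
  by apply/funext => z; rewrite !mxE.
have := is_derive_add (is_derive_cst (xi 0 i) t 1)
  (is_derive_mul (is_derive_id t 1) (is_derive_cst (v 0 i) t 1)).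
by rewrite add0r mul1r mulr0 addr0.
Qed.

Lemma is_derive_dot_line w (t : R) :
  is_derive t 1 (fun t => dot w (line t)) (dot w v).
Proof.
have := @is_derive_sum _ _ _ m (fun i t => w 0 i * line t 0 i) t 1
  (fun i => w 0 i * v 0 i).
rewrite (_ : \sum_i _ = fun t => dot w (line t)); last first.
  by apply/funext => z; rewrite fct_sumE.
apply => i.
have := is_derive_mul (is_derive_cst (w 0 i) t 1) (is_derive_coord_line i t).
by rewrite mul0r add0r.
Qed.

Lemma is_derive_sqnorm_line (t : R) :
  is_derive t 1 (fun t => sqnorm (line t)) (2 * dot v (line t)).
Proof.
have := @is_derive_sum _ _ _ m (fun i t => line t 0 i * line t 0 i) t 1
  (fun i => v 0 i * line t 0 i + line t 0 i * v 0 i).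
rewrite (_ : \sum_i _ = fun t => sqnorm (line t)); last first.
  by apply/funext => z; rewrite fct_sumE; apply: eq_bigr => i _; rewrite expr2.
rewrite (_ : \sum_i _ = 2 * dot v (line t)); last first.
  by rewrite /dot mulr_sumr; apply: eq_bigr => i _; ring.
by apply => i; exact: (is_derive_mul (is_derive_coord_line i t) (is_derive_coord_line i t)).
Qed.

Lemma is_derive_ev (e : multiplier) (t : R) : 0 < line t 0 k ->
  is_derive t 1 (fun t => ev e (line t)) (ev (dmult v e) (line t)).
Proof.
move=> y0; have y0' : line t 0 k != 0 by rewrite gt_eqF.
have r0 : sqnorm (line t) != 0 by rewrite gt_eqF// sqnorm_gt0.
have dr := @is_derive_inv _ (fun t => sqnorm (line t)) _ _ r0 (is_derive_sqnorm_line t).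
elim: e => [c|||w|e1 IH1 e2 IH2|e1 IH1 e2 IH2] /=.
- exact: is_derive_cst.
- apply: is_derive_eq.
    exact: (@is_derive_inv _ (fun t => line t 0 k) _ _ y0' (is_derive_coord_line k t)).
  by move=> /=; field.
- by apply: is_derive_eq => /=; field.
- apply: is_derive_eq; first exact: (is_derive_mul (is_derive_dot_line w t) dr).
  by move=> /=; field.
- exact: is_derive_add.
- exact: is_derive_mul.
Qed.

End line.

(** Both c and |xi_i| are at most the Euclidean norm of xi, so that c |xi_i| is at
most its square. *)
Lemma coord_le_sqnorm (c : R) xi i : 0 < c -> c <= xi 0 k ->
  `|xi 0 i| / sqnorm xi <= c^-1.
Proof.
move=> c0 cy; have y0 : 0 < xi 0 k by exact: lt_le_trans cy.
rewrite ler_pdivrMr ?sqnorm_gt0// mulrC ler_pdivlMr//.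
have h1 := sqr_coord_le_sqnorm xi i; have h2 := sqr_coord_le_sqnorm xi k.
have h3 : c ^+ 2 <= xi 0 k ^+ 2 by rewrite lerXn2r// nnegrE ltW.
have h4 : 0 <= (`|xi 0 i| - c) ^+ 2 by rewrite sqr_ge0.
have h5 : `|xi 0 i| ^+ 2 = xi 0 i ^+ 2 by rewrite real_normK// num_real.
nra.
Qed.

Lemma slope_le (c : R) w xi : 0 < c -> c <= xi 0 k ->
  `|ev (Slope w) xi| <= c^-1 * norm1 w.
Proof.
move=> c0 cy; have r0 : 0 < sqnorm xi by rewrite sqnorm_gt0// (lt_le_trans c0).
rewrite /= normrM [`|_^-1|]gtr0_norm ?invr_gt0// -ler_pdivlMr ?invr_gt0// invrK.
apply: (le_trans (ler_norm_sum _ _ _)).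
rewrite /norm1 [c^-1 * _]mulr_sumr mulr_suml; apply: ler_sum => i _.
rewrite normrM mulrC mulrAC ler_wpM2r//.
by rewrite -ler_pdivrMr//; exact: coord_le_sqnorm.
Qed.

Lemma ev_bounded (e : multiplier) (c : R) : 0 < c ->
  exists2 C, 0 <= C & forall xi, c <= xi 0 k -> `|ev e xi| <= C.
Proof.
move=> c0; elim: e => [d|||w|e1 [C1 C10 H1] e2 [C2 C20 H2]|e1 [C1 C10 H1] e2 [C2 C20 H2]].
- by exists `|d|.
- exists c^-1 => [|xi cy]; first by rewrite invr_ge0 ltW.
  have y0 : 0 < xi 0 k by exact: lt_le_trans cy.
  by rewrite /= gtr0_norm ?invr_gt0// lef_pV2 ?posrE.
- exists (c ^+ 2)^-1 => [|xi cy]; first by rewrite invr_ge0 exprn_ge0 ?ltW.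
  have y0 : 0 < xi 0 k by exact: lt_le_trans cy.
  have r0 := sqnorm_gt0 y0.
  rewrite /= gtr0_norm ?invr_gt0// lef_pV2 ?posrE ?exprn_gt0//.
  by rewrite (le_trans _ (sqr_coord_le_sqnorm xi k))// lerXn2r// nnegrE ltW.
- exists (c^-1 * norm1 w) => [|xi]; last exact: slope_le.
  by rewrite mulr_ge0 ?invr_ge0 ?norm1_ge0 ?ltW.
- exists (C1 + C2) => [|xi cy]; first exact: addr_ge0.
  by rewrite (le_trans (ler_normD _ _))// lerD ?H1 ?H2.
- exists (C1 * C2) => [|xi cy]; first exact: mulr_ge0.
  by rewrite /= normrM ler_pM ?H1 ?H2.
Qed.

(** The bound is uniform in the direction v and proportional to its size, as the
mean value theorem will need. *)
Lemma dmult_bounded (e : multiplier) (c : R) : 0 < c ->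
  exists2 C, 0 <= C & forall v xi, c <= xi 0 k ->
    `|ev (dmult v e) xi| <= C * norm1 v.
Proof.
move=> c0; have ic0 : 0 <= c^-1 by rewrite invr_ge0 ltW.
elim: e => [d|||w|e1 [C1 C10 H1] e2 [C2 C20 H2]|e1 [C1 C10 H1] e2 [C2 C20 H2]].
- by exists 0 => // v xi _; rewrite /= normr0 mul0r.
- have [C C0 H] := ev_bounded (Mul Yinv Yinv) c0.
  exists C => // v xi cy; rewrite /= normrM mulrC normrN ler_pM//.
    exact: H.
  exact: coord_le_norm1.
- have [C C0 H] := ev_bounded Rinv c0.
  exists (2 * C * c^-1) => [|v xi cy]; first by rewrite !mulr_ge0.
  rewrite (_ : 2 * C * _ * _ = 2 * (C * (c^-1 * norm1 v))); last by ring.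
  rewrite -[ev _ _]/(- 2 * (ev Rinv xi * ev (Slope v) xi)).
  by rewrite normrM normrN normr_nat ler_wpM2l// normrM ler_pM ?H ?slope_le.
- have [C C0 H] := ev_bounded Rinv c0.
  have [C' C'0 H'] := ev_bounded (Slope w) c0.
  exists (norm1 w * C + 2 * C' * c^-1) => [|v xi cy].
    by rewrite addr_ge0 ?mulr_ge0 ?norm1_ge0.
  rewrite -[ev _ _]/(dot w v * ev Rinv xi + - 2 * (ev (Slope w) xi * ev (Slope v) xi)).
  rewrite (le_trans (ler_normD _ _))// mulrDl lerD//.
    rewrite normrM mulrAC ler_pM ?H//.
    rewrite (le_trans (ler_norm_sum _ _ _))// [leRHS]mulr_sumr ler_sum// => i _.
    by rewrite normrM ler_wpM2r// coord_le_norm1.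
  rewrite (_ : 2 * C' * _ * _ = 2 * (C' * (c^-1 * norm1 v))); last by ring.
  by rewrite normrM normrN normr_nat ler_wpM2l// normrM ler_pM ?H' ?slope_le.
- exists (C1 + C2) => [|v xi cy]; first exact: addr_ge0.
  by rewrite (le_trans (ler_normD _ _))// mulrDl lerD ?H1 ?H2.
- have [C1' C1'0 H1'] := ev_bounded e1 c0.
  have [C2' C2'0 H2'] := ev_bounded e2 c0.
  exists (C1 * C2' + C1' * C2) => [|v xi cy]; first by rewrite addr_ge0 ?mulr_ge0.
  rewrite (le_trans (ler_normD _ _))// mulrDl lerD//= normrM.
    by rewrite mulrAC ler_pM ?H1 ?H2'.
  by rewrite -mulrA ler_pM ?H1' ?H2.
Qed.

End multipliers.

(** * Lipschitz and Taylor estimates for kernels *)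
Section kernels.
Context {R : realType} (m : nat) (k : 'I_m) (a b : R).
Hypotheses (a0 : 0 <= a) (b0 : 0 <= b).
Implicit Types (v w xi : 'rV[R]_m) (e : @multiplier R m).

(** With a = 2 s, b = n / 2 + s and k the last coordinate, this is the Poisson kernel
without its constant. *)
Definition base xi : R := xi 0 k `^ a / sqnorm xi `^ b.

(** The logarithmic derivative of base in the direction v. *)
Definition dlog v : @multiplier R m :=
  Add (Mul (@Cst R m (a * v 0 k)) (@Yinv R m)) (Mul (@Cst R m (- (2 * b))) (Slope v)).

Definition dker v e := Add (Mul e (dlog v)) (dmult k v e).

Definition kern e xi : R := base xi * ev k e xi.

Lemma is_derive_kern xi v e (t : R) : 0 < (xi + t *: v) 0 k ->
  is_derive t 1 (fun t => kern e (xi + t *: v)) (kern (dker v e) (xi + t *: v)).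
Proof.
move=> y0; have y0' : (xi + t *: v) 0 k != 0 by rewrite gt_eqF.
have r0 := sqnorm_gt0 y0.
have pred (x c : R) : 0 < x -> x `^ (c - 1) = x `^ c / x.
  by move=> x0; rewrite [LHS]powRB ?(gt_eqF x0) ?implybT// powRr1 ?ltW.
have dy := @is_derive_powR _ (fun t => (xi + t *: v) 0 k) _ _ a y0
  (is_derive_coord_line xi v k t).
have dr := @is_derive_powR _ (fun t => sqnorm (xi + t *: v)) _ _ b r0
  (is_derive_sqnorm_line xi v t).
have rb0 : sqnorm (xi + t *: v) `^ b != 0 by rewrite gt_eqF// powR_gt0.
have drV := @is_derive_inv _ (fun t => sqnorm (xi + t *: v) `^ b) _ _ rb0 dr.
have r0' : sqnorm (xi + t *: v) != 0 by rewrite gt_eqF.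
apply: is_derive_eq.
  exact: (is_derive_mul (is_derive_mul dy drV) (is_derive_ev e y0)).
rewrite /kern /base /= !pred//.
by field; rewrite y0' rb0 r0'.
Qed.

Lemma ev_dmultZ (h : R) v e xi : ev k (dmult k (h *: v) e) xi = h * ev k (dmult k v e) xi.
Proof.
have dotZr w : dot w (h *: v) = h * dot w v by rewrite dotC dotZl dotC.
elim: e => [c|||w|e1 IH1 e2 IH2|e1 IH1 e2 IH2] /=; rewrite ?mxE ?dotZl ?dotZr ?IH1 ?IH2; ring.
Qed.

Lemma kern_dkerZ (h : R) v e xi : kern (dker (h *: v) e) xi = h * kern (dker v e) xi.
Proof.
by rewrite /kern /= ev_dmultZ mxE dotZl; ring.
Qed.

Lemma dker_bounded e (c : R) : 0 < c ->
  exists2 C, 0 <= C & forall v xi, c <= xi 0 k -> `|ev k (dker v e) xi| <= C * norm1 v.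
Proof.
move=> c0; have [C1 C10 H1] := ev_bounded k e c0; have [C2 C20 H2] := dmult_bounded k e c0.
have ic0 : 0 <= c^-1 by rewrite invr_ge0 ltW.
exists (C1 * (a * c^-1 + 2 * b * c^-1) + C2) => [|v xi cy].
  by rewrite addr_ge0// mulr_ge0// addr_ge0// !mulr_ge0.
rewrite -[ev _ _ _]/(ev k e xi * (a * v 0 k * (xi 0 k)^-1 + - (2 * b) * ev k (Slope v) xi)
  + ev k (dmult k v e) xi).
rewrite (le_trans (ler_normD _ _))// [leRHS]mulrDl lerD ?H2//.
rewrite normrM -[leRHS]mulrA ler_pM ?H1//.
rewrite (le_trans (ler_normD _ _))// [leRHS]mulrDl lerD//.
  rewrite !normrM ger0_norm// -!mulrA ler_wpM2l// mulrC ler_pM// ?coord_le_norm1//.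
  have y0 : 0 < xi 0 k by exact: lt_le_trans cy.
  by rewrite /= gtr0_norm ?invr_gt0// lef_pV2 ?posrE.
have b20 : 0 <= 2 * b by rewrite mulr_ge0.
rewrite (normrM (- (2 * b))) normrN (ger0_norm b20).
rewrite (_ : 2 * b * _ * _ = 2 * b * (c^-1 * norm1 v)); last by rewrite mulrA.
apply: ler_wpM2l => //; exact: slope_le.
Qed.

(** xi = (xi + v) - v gives |xi|^2 <= 2 |xi + v|^2 + 2 |v|^2, and |v| is at most half
the height of xi, hence at most the height of xi + v. *)
Lemma sqnorm_near xi v : norm1 v <= xi 0 k / 2 -> 0 < xi 0 k ->
  sqnorm xi <= 4 * sqnorm (xi + v).
Proof.
move=> vy y0.
have vk : `|v 0 k| <= xi 0 k / 2 by exact: le_trans (coord_le_norm1 _ _) _.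
have yk : (xi 0 k / 2) ^+ 2 <= sqnorm (xi + v).
  apply: le_trans (sqr_coord_le_sqnorm _ k); rewrite mxE.
  by move: vk; rewrite ler_norml => /andP[h1 h2]; rewrite lerXn2r// ?nnegrE; lra.
have vs : sqnorm v <= (xi 0 k / 2) ^+ 2.
  apply: (@le_trans _ _ (norm1 v ^+ 2)); last first.
    by rewrite lerXn2r// nnegrE ?norm1_ge0// divr_ge0// ltW.
  rewrite expr2 {1}/norm1 mulr_suml; apply: ler_sum => i _.
  rewrite -real_normK ?num_real// expr2 ler_wpM2l//; exact: coord_le_norm1.
have : sqnorm xi <= 2 * sqnorm (xi + v) + 2 * sqnorm v.
  rewrite /sqnorm !mulr_sumr -big_split/=; apply: ler_sum => i _.
  rewrite mxE -subr_ge0 (_ : _ - _ = (xi 0 i + 2 * v 0 i) ^+ 2) ?sqr_ge0//.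
  by ring.
by move=> h; lra.
Qed.

Lemma base_near xi v : norm1 v <= xi 0 k / 2 -> 0 < xi 0 k ->
  0 <= base (xi + v) <= (2 * xi 0 k) `^ a * 4 `^ b / sqnorm xi `^ b.
Proof.
move=> vy y0; have r0 := sqnorm_gt0 y0.
have vk : `|v 0 k| <= xi 0 k / 2 by exact: le_trans (coord_le_norm1 _ _) _.
have y1 : 0 < (xi + v) 0 k by move: vk; rewrite mxE ler_norml => /andP[h1 h2]; lra.
have r1 := sqnorm_gt0 y1.
rewrite divr_ge0 ?powR_ge0//= /base -mulrA ler_pM ?powR_ge0 ?invr_ge0 ?powR_ge0//.
  apply: ge0_ler_powR => //; rewrite ?nnegrE ?ltW ?mulr_gt0//.
  by move: vk; rewrite mxE ler_norml => /andP[h1 h2]; lra.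
rewrite ler_pdivlMr ?powR_gt0// mulrC ler_pdivrMr ?powR_gt0//.
rewrite -powRM ?(ltW r1)//; apply: ge0_ler_powR => //.
  1, 2: by rewrite nnegrE ?mulr_ge0 ?(ltW r1) ?(ltW r0).
exact: sqnorm_near.
Qed.

Lemma kern_mean_value e xi v : 0 < xi 0 k -> norm1 v <= xi 0 k / 2 ->
  exists t : R, [/\ norm1 (t *: v) <= norm1 v,
    xi 0 k / 2 <= (xi + t *: v) 0 k &
    kern e (xi + v) - kern e xi = kern (dker v e) (xi + t *: v)].
Proof.
move=> y0 vy.
have nvt (t : R) : t \in `[0, 1] -> norm1 (t *: v) <= norm1 v.
  rewrite in_itv/= => /andP[t0 t1]; rewrite norm1Z ger0_norm//.
  by rewrite ler_piMl ?norm1_ge0.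
have yt (t : R) : t \in `[0, 1] -> xi 0 k / 2 <= (xi + t *: v) 0 k.
  move=> /nvt tv; rewrite [leRHS]mxE.
  have := le_trans (coord_le_norm1 (t *: v) k) (le_trans tv vy).
  by rewrite ler_norml => /andP[h1 h2]; lra.
have ds (t : R) : t \in `[0, 1] ->
    is_derive t 1 (fun t => kern e (xi + t *: v)) (kern (dker v e) (xi + t *: v)).
  by move=> /yt h; apply: is_derive_kern; apply: lt_le_trans h; rewrite divr_gt0.
have ct : {within `[0 : R, 1], continuous (fun t => kern e (xi + t *: v))}.
  by apply: derivable_within_continuous => t /ds[].
have dt (t : R) : t \in `]0, 1[ ->
    is_derive t 1 (fun t => kern e (xi + t *: v)) (kern (dker v e) (xi + t *: v)).
  by move=> t01; apply: ds; exact: subset_itv_oo_cc t01.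
have [t t01] := MVT_segment ler01 dt ct.
rewrite scale1r scale0r addr0 subr0 mulr1 => E.
by exists t; split => //; [exact: nvt|exact: yt].
Qed.

(** The constant depends on xi through its height y only. This is what makes the
estimate integrable: for xi = p - (x, 0) the height does not vary with x. *)
Lemma kern_lipschitz e (y : R) : 0 < y -> exists2 C, 0 <= C &
  forall xi v, xi 0 k = y -> norm1 v <= y / 2 ->
  `|kern e (xi + v) - kern e xi| <= C * norm1 v / sqnorm xi `^ b.
Proof.
move=> y0; have y20 : 0 < y / 2 by rewrite divr_gt0.
have [C C0 H] := dker_bounded e y20.
exists ((2 * y) `^ a * 4 `^ b * C) => [|xi v xy vy].
  by rewrite !mulr_ge0 ?powR_ge0.
have [||t [tv yt ->]] := @kern_mean_value e xi v; rewrite ?xy//.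
rewrite xy in yt.
have /andP[B0 B1] : 0 <= base (xi + t *: v) <= (2 * y) `^ a * 4 `^ b / sqnorm xi `^ b.
  by rewrite -[in 2 * y]xy; apply: base_near; rewrite xy// (le_trans tv).
rewrite normrM (ger0_norm B0).
rewrite (_ : _ * _ / _ = (2 * y) `^ a * 4 `^ b / sqnorm xi `^ b * (C * norm1 v)); last by ring.
by rewrite ler_pM// H.
Qed.

(** By the mean value theorem the remainder is the increment of the derivative,
which is itself a kernel and satisfies the Lipschitz estimate. *)
Lemma kern_taylor e v (y : R) : 0 < y -> exists2 C, 0 <= C &
  forall xi (h : R), xi 0 k = y -> norm1 (h *: v) <= y / 2 ->
  `|kern e (xi + h *: v) - kern e xi - h * kern (dker v e) xi|
    <= C * h ^+ 2 / sqnorm xi `^ b.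
Proof.
move=> y0; have [C C0 H] := kern_lipschitz (dker v e) y0.
exists (C * norm1 v) => [|xi h xy vy]; first by rewrite mulr_ge0 ?norm1_ge0.
have [||t [tv _ ->]] := @kern_mean_value e xi (h *: v); rewrite ?xy//.
rewrite kern_dkerZ -mulrBr normrM.
have /(H xi _ xy) : norm1 (t *: (h *: v)) <= y / 2 by exact: le_trans tv _.
move=> /(ler_wpM2l (normr_ge0 h)) /le_trans; apply.
rewrite (_ : C * norm1 v * h ^+ 2 / _ = `|h| * (C * norm1 (h *: v) / sqnorm xi `^ b)).
  by rewrite ler_wpM2l// ler_wpM2r ?invr_ge0 ?powR_ge0// ler_wpM2l.
by rewrite norm1Z -[h ^+ 2]real_normK ?num_real//; ring.
Qed.

Lemma kern_bounded e (y : R) : 0 < y -> exists2 C, 0 <= C &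
  forall xi, xi 0 k = y -> `|kern e xi| <= C / sqnorm xi `^ b.
Proof.
move=> y0; have [C C0 H] := ev_bounded k e y0.
exists (y `^ a * C) => [|xi xy]; first by rewrite mulr_ge0 ?powR_ge0.
rewrite /kern /base normrM xy ger0_norm ?divr_ge0 ?powR_ge0// mulrAC.
by rewrite ler_wpM2r ?invr_ge0 ?powR_ge0// ler_wpM2l ?powR_ge0// H// xy.
Qed.

End kernels.

(** * Measurability of kernels *)
Section measurability.
Context {R : realType} (m : nat) (k : 'I_m) d (T : measurableType d).
Variable (phi : T -> 'rV[R]_m).
Hypotheses (mphi : forall i, measurable_fun setT (fun t => phi t 0 i))
  (phi0 : forall t, 0 < phi t 0 k).

(** On positive numbers the inverse is the power of exponent -1. *)
Lemma measurable_inv_gt0 (f : T -> R) : (forall t, 0 < f t) ->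
  measurable_fun setT f -> measurable_fun setT (fun t => (f t)^-1).
Proof.
move=> f0 mf; rewrite (_ : (fun _ => _) = (fun t => f t `^ (-1))).
  exact: (measurableT_comp (measurable_powR _) mf).
by apply/funext => t; rewrite powR_inv1// ltW.
Qed.

Lemma measurable_sqnorm_comp : measurable_fun setT (fun t => sqnorm (phi t)).
Proof. by apply: measurable_sum => i; exact: measurable_funX. Qed.

Let sqnorm_phi0 t : 0 < sqnorm (phi t). Proof. exact: sqnorm_gt0. Qed.

Lemma measurable_ev (e : @multiplier R m) : measurable_fun setT (fun t => ev k e (phi t)).
Proof.
elim: e => [c|||w|e1 IH1 e2 IH2|e1 IH1 e2 IH2] /=.
- exact: measurable_cst.
- exact: measurable_inv_gt0.
- by apply: measurable_inv_gt0 => //; exact: measurable_sqnorm_comp.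
- apply: measurable_funM.
    by apply: measurable_sum => i; exact: measurable_funM.
  by apply: measurable_inv_gt0 => //; exact: measurable_sqnorm_comp.
- exact: measurable_funD.
- exact: measurable_funM.
Qed.

Lemma measurable_kern a b (e : @multiplier R m) :
  measurable_fun setT (fun t => kern k a b e (phi t)).
Proof.
apply: measurable_funM; last exact: measurable_ev.
apply: measurable_funM.
  exact: (measurableT_comp (measurable_powR _) (mphi k)).
apply: measurable_inv_gt0; first by move=> t; rewrite powR_gt0.
exact: (measurableT_comp (measurable_powR _) measurable_sqnorm_comp).
Qed.

End measurability.

(** * Integrals of dominated functions *)
Section domination.
Context d (T : measurableType d) {R : realType} (mu : {measure set T -> \bar R}).
Variables (f g : T -> R) (K : R).
Hypotheses (mf : measurable_fun setT f)
  (ig : mu.-integrable setT (EFin \o g)) (fg : forall x, `|f x| <= K * g x).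

Let iKg : mu.-integrable setT (EFin \o (fun x => K * g x)).
Proof. by have := integrableZl measurableT K ig. Qed.

Lemma dominated_integrable : mu.-integrable setT (EFin \o f).
Proof.
apply: (le_integrable measurableT _ _ iKg); first exact/measurable_EFinP.
move=> x _ /=; rewrite lee_fin [leRHS]ger0_norm//.
exact: le_trans (fg x).
Qed.

Lemma norm_Rintegral_dominated :
  `|\int[mu]_x f x| <= K * \int[mu]_x g x.
Proof.
rewrite -RintegralZl//; apply: le_trans (le_normr_Rintegral _ _) _ => //.
  exact: dominated_integrable.
apply: le_Rintegral => //.
have := integrable_abse dominated_integrable.
by apply: eq_integrable => // x _; rewrite /= abse_EFin.
Qed.

End domination.

(** * Locality of continuity and differentiability *)
Section neighbourhoods.
Context {R : realType} (n : nat).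

Lemma near_norm1 N (p : 'rV[R]_N) (eta : R) : 0 < eta ->
  \forall q \near p, norm1 (q - p) < eta.
Proof.
move=> eta0; apply/nbhs_ballP; exists (eta / N.+1%:R) => /= [|q [_ pq]].
  by rewrite divr_gt0.
(* Dividing by N + 1 rather than N makes the last inequality strict. *)
apply: (@le_lt_trans _ _ (\sum_(i < N) eta / N.+1%:R)).
  apply: ler_sum => i _; have := pq 0 i; rewrite /ball/= => /ltW.
  by rewrite distrC !mxE.
rewrite sumr_const card_ord -[ltLHS]mulr_natr -[ltLHS]mulrA gtr_pMr//.
by rewrite mulrC ltr_pdivrMr// mul1r ltr_nat.
Qed.

Lemma halfspace_open : open (@halfspace R n).
Proof.
rewrite (_ : @halfspace R n = (fun p : 'rV[R]_(n + 1) => p 0 (yindex n)) @^-1` [set x | 0 < x])//.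
apply: open_comp; last exact: open_gt.
by move=> p _; exact: coord_continuous.
Qed.

Lemma near_halfspace (p : 'rV[R]_(n + 1)) (P : 'rV[R]_(n + 1) -> Prop) : 0 < ypart p ->
  (forall q, 0 < ypart q -> P q) -> \forall q \near p, P q.
Proof.
move=> p0 h; have := open_nbhs_nbhs (conj halfspace_open (p0 : halfspace p)).
exact: filterS.
Qed.

Lemma Ck_ext j m (A : set 'rV[R]_m) (f g : 'rV[R]_m -> R) : open A ->
  (forall x, A x -> f x = g x) -> Ck j A f -> Ck j A g.
Proof.
move=> oA; have nA (P : 'rV[R]_m -> Prop) x : A x -> (forall y, A y -> P y) ->
    \forall y \near x, P y.
  by move=> Ax h; have := open_nbhs_nbhs (conj oA Ax); exact: filterS.
have cg h1 h2 x : (forall y, A y -> h1 y = h2 y) -> A x ->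
    {for x, continuous h1} -> {for x, continuous h2}.
  move=> h12 Ax ch; suff : h2 y @[y --> nbhs x] --> h2 x by [].
  rewrite -h12//; apply: cvg_trans ch.
  by apply: near_eq_cvg; apply: nA Ax _ => y Ay; rewrite h12.
elim: j f g => [|j IH] f g fg [cf df].
  by split=> // x Ax; exact: cg (cf x Ax).
split; first by move=> x Ax; exact: cg (cf x Ax).
move=> i; have [di ci] := df i; split => [x Ax|].
  by apply: near_eq_derivable (di x Ax); apply: nA.
by apply: IH ci => x Ax; apply: near_eq_derive; apply: nA.
Qed.

End neighbourhoods.

(** * Potentials: smoothness and the differential equation *)
Section potential.
Context {R : realType} (n : nat) (s : R).
Hypothesis s0 : 0 < s.
Variables (u : 'rV[R]_n -> R) (M : R).
Hypotheses (meas_u : measurable_fun setT u) (uM : forall x, `|u x| <= M).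

Let k : 'I_(n + 1) := yindex n.
Let a : R := 2 * s.
Let b : R := n%:R / 2 + s.
Let mu := @lebesgue_rV R n.
Notation multiplier := (@multiplier R (n + 1)).
Implicit Types (p v : 'rV[R]_(n + 1)) (e : multiplier).

Let a0 : 0 <= a. Proof. by rewrite mulr_ge0// ltW. Qed.
Let b0 : 0 <= b. Proof. by rewrite addr_ge0 ?divr_ge0// ltW. Qed.

Definition boundary_pt (x : 'rV[R]_n) : 'rV[R]_(n + 1) := rVpoint x 0.

Lemma boundary_pt_ypart x : boundary_pt x 0 k = 0.
Proof. by rewrite /boundary_pt /rVpoint row_mxEr mxE mulr1n. Qed.

Lemma boundary_pt_lshift x j : boundary_pt x 0 (lshift 1 j) = x 0 j.
Proof. by rewrite /boundary_pt /rVpoint row_mxEl. Qed.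

Lemma sqnorm_boundary_pt p x : sqnorm (p - boundary_pt x) = sqnorm (xpart p - x) + ypart p ^+ 2.
Proof.
rewrite {1}/sqnorm big_split_ord/= big_ord1; congr (_ + _).
  by apply: eq_bigr => i _; rewrite [X in X ^+ 2]mxE [X in _ + X]mxE boundary_pt_lshift !mxE.
by rewrite mxE [X in _ + X]mxE boundary_pt_ypart subr0.
Qed.

Let shiftE p x : (p - boundary_pt x) 0 k = ypart p.
Proof. by rewrite mxE [X in _ + X]mxE boundary_pt_ypart subr0. Qed.

Let mshift p i : measurable_fun setT (fun x => (p - boundary_pt x) 0 i).
Proof.
case: (split_ordP i) => j ->.
  rewrite (_ : (fun _ => _) = (fun x => p 0 (lshift 1 j) - rV_coord j x)).
    by apply: measurable_funB => //; exact: measurable_rV_coord.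
  by apply/funext => x; rewrite mxE [X in _ + X]mxE boundary_pt_lshift.
rewrite (_ : (fun _ => _) = cst (p 0 (rshift n j)))//.
by apply/funext => x; rewrite (ord1 j) mxE [X in _ + X]mxE boundary_pt_ypart subr0.
Qed.

(** The common majorant of all kernels at p, up to constants. *)
Definition weight p (x : 'rV[R]_n) : R := (sqnorm (p - boundary_pt x) `^ b)^-1.

Lemma integrable_weight p : 0 < ypart p -> mu.-integrable setT (EFin \o weight p).
Proof.
move=> y0; apply/integrableP; split.
  apply/measurable_EFinP; apply: measurable_inv_gt0.
    by move=> x; rewrite powR_gt0// (@sqnorm_gt0 _ _ k)// shiftE.
  exact: (measurableT_comp (measurable_powR _) (measurable_sqnorm_comp (mshift p))).
under eq_integral => x _.
  rewrite /= ger0_norm ?invr_ge0 ?powR_ge0// /weight sqnorm_boundary_pt.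
  over.
by rewrite integral_rV_kernel// ltry.
Qed.

(** The Poisson integral is the potential of a constant multiplier, and the
directional derivatives of potentials are potentials. *)
Definition potential e p : R := \int[mu]_x (kern k a b e (p - boundary_pt x) * u x).

Let mpot e p : 0 < ypart p ->
  measurable_fun setT (fun x => kern k a b e (p - boundary_pt x) * u x).
Proof.
move=> y0; apply: measurable_funM => //; apply: measurable_kern; first exact: mshift.
by move=> x; rewrite shiftE.
Qed.

Let M0 : 0 <= M. Proof. exact: le_trans (normr_ge0 _) (uM 0). Qed.

Let ipot e p : 0 < ypart p ->
  mu.-integrable setT (EFin \o (fun x => kern k a b e (p - boundary_pt x) * u x)).
Proof.
move=> y0; have [C C0 H] := kern_bounded k a b e y0.
apply: (@dominated_integrable _ _ _ _ _ (weight p) (C * M)).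
- exact: mpot.
- exact: integrable_weight.
- move=> x; rewrite normrM mulrAC ler_pM// H// shiftE//.
Qed.

Let shiftD p v x : p + v - boundary_pt x = p - boundary_pt x + v.
Proof. by rewrite addrAC. Qed.

Let ypartD_gt0 p v : 0 < ypart p -> norm1 v <= ypart p / 2 -> 0 < ypart (p + v).
Proof.
rewrite /ypart mxE => y0 /(le_trans (coord_le_norm1 v k)).
by rewrite ler_norml => /andP[h1 h2]; move: h1 y0; lra.
Qed.

Lemma potential_lipschitz e p : 0 < ypart p -> exists2 C, 0 <= C &
  forall v, norm1 v <= ypart p / 2 ->
  `|potential e (p + v) - potential e p| <= C * norm1 v.
Proof.
move=> y0; have [C C0 H] := kern_lipschitz k a0 b0 e y0.
exists (C * M * \int[mu]_x weight p x) => [|v vy].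
  rewrite !mulr_ge0//; apply: Rintegral_ge0 => x _.
  by rewrite invr_ge0 powR_ge0.
have y1 := ypartD_gt0 y0 vy.
rewrite -RintegralB//; [|exact: ipot|exact: ipot].
rewrite mulrAC; apply: norm_Rintegral_dominated.
- by apply: measurable_funB; exact: mpot.
- exact: integrable_weight.
- move=> x; rewrite -mulrBl normrM shiftD.
  rewrite [leRHS](_ : _ = C * norm1 v * weight p x * M); last by ring.
  by rewrite ler_pM// H// shiftE.
Qed.

Lemma potential_taylor e v p : 0 < ypart p -> exists2 C, 0 <= C &
  forall h : R, norm1 (h *: v) <= ypart p / 2 ->
  `|potential e (p + h *: v) - potential e p - h * potential (dker k a b v e) p|
     <= C * h ^+ 2.
Proof.
move=> y0; have [C C0 H] := kern_taylor k a0 b0 e v y0.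
exists (C * M * \int[mu]_x weight p x) => [|h vy].
  rewrite !mulr_ge0//; apply: Rintegral_ge0 => x _.
  by rewrite invr_ge0 powR_ge0.
have y1 := ypartD_gt0 y0 vy.
have ih : mu.-integrable setT
    (EFin \o (fun x => h * (kern k a b (dker k a b v e) (p - boundary_pt x) * u x))).
  by have := integrableZl measurableT h (ipot (dker k a b v e) y0).
rewrite -RintegralB//; [|exact: ipot|exact: ipot].
rewrite -RintegralZl//; last exact: ipot.
rewrite -RintegralB//; last first.
  have := integrableB measurableT (ipot e y1) (ipot e y0).
  by apply: eq_integrable.
rewrite mulrAC; apply: norm_Rintegral_dominated.
- apply: measurable_funB; last by apply: measurable_funM => //; exact: mpot.
  by apply: measurable_funB; exact: mpot.
- exact: integrable_weight.
- move=> x; rewrite mulrA -!mulrBl normrM shiftD.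
  rewrite [leRHS](_ : _ = C * h ^+ 2 * weight p x * M); last by ring.
  by rewrite ler_pM// H// shiftE.
Qed.

Lemma potential_continuous e p : 0 < ypart p -> {for p, continuous (potential e)}.
Proof.
move=> p0; have [C C0 H] := potential_lipschitz e p0.
suff : potential e q @[q --> nbhs p] --> potential e p by [].
apply/cvgrPdist_lt => eps eps0.
have d0 : 0 < Num.min (ypart p / 2) (eps / (C + 1)).
  by rewrite lt_min !divr_gt0// ltr_wpDl.
have := near_norm1 p d0; apply: filterS => q.
rewrite lt_min => /andP[q1 q2]; rewrite distrC -[in potential e q](subrK p q) [q - p + p]addrC.
apply: le_lt_trans (H _ (ltW q1)) _.
apply: (@le_lt_trans _ _ ((C + 1) * norm1 (q - p))).
  by rewrite ler_wpM2r ?norm1_ge0// lerDl.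
by rewrite mulrC -ltr_pdivlMr// ltr_wpDl.
Qed.

(** Differentiation under the integral sign, directly from the quadratic bound on
the Taylor remainder of the potential. *)
Lemma is_derive_potential e v p : 0 < ypart p ->
  is_derive p v (potential e) (potential (dker k a b v e) p).
Proof.
move=> p0; have [C C0 H] := potential_taylor e v p0.
set l := potential (dker k a b v e) p.
have L : h^-1 *: (potential e (h *: v + p) - potential e p) @[h --> 0^'] --> l.
  apply/cvgrPdist_lt => eps eps0.
  pose d := Num.min (ypart p / 2 / (norm1 v + 1)) (eps / (C + 1)).
  have v1 : 0 < norm1 v + 1 by rewrite ltr_wpDl ?norm1_ge0.
  have C1 : 0 < C + 1 by rewrite ltr_wpDl.
  have d0 : 0 < d by rewrite lt_min !divr_gt0.
  near=> h.
  have h0 : h != 0 by near: h; exact: nbhs_dnbhs_neq.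
  have hd : `|h| < d by near: h; exact: dnbhs0_lt.
  have ah0 : 0 < `|h| by rewrite normr_gt0.
  move: hd; rewrite lt_min => /andP[h1 h2].
  have hv : norm1 (h *: v) <= ypart p / 2.
    rewrite norm1Z; apply: (@le_trans _ _ (`|h| * (norm1 v + 1))).
      by rewrite ler_wpM2l// lerDl.
    by rewrite -ler_pdivlMr// ltW.
  have -> : l - h^-1 *: (potential e (h *: v + p) - potential e p) =
    - h^-1 * (potential e (p + h *: v) - potential e p - h * l).
    by rewrite [_ + p]addrC /GRing.scale/=; field.
  rewrite normrM normrN normfV mulrC ltr_pdivrMr//.
  apply: le_lt_trans (H _ hv) _.
  rewrite -[h ^+ 2]real_normK ?num_real// expr2 mulrA ltr_pM2r//.
  apply: (@le_lt_trans _ _ ((C + 1) * `|h|)); first by rewrite ler_wpM2r// lerDl.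
  by rewrite mulrC -ltr_pdivlMr.
split; first by apply/cvg_ex; exists l.
exact/cvg_lim.
Unshelve. all: end_near. Qed.

Lemma partial_potential e i p : 0 < ypart p ->
  partial i (potential e) p = potential (dker k a b (delta_mx 0 i) e) p.
Proof. by move=> p0; have [_ <-] := is_derive_potential e (delta_mx 0 i) p0. Qed.

Lemma partial_partial_potential e i p : 0 < ypart p ->
  partial i (partial i (potential e)) p =
  potential (dker k a b (delta_mx 0 i) (dker k a b (delta_mx 0 i) e)) p.
Proof.
move=> p0; rewrite -partial_potential//; apply: near_eq_derive.
by apply: near_halfspace => // q; exact: partial_potential.
Qed.

Lemma Ck_potential j e : Ck j (@halfspace R n) (potential e).
Proof.
elim: j e => [|j IH] e; first by split=> // p; exact: potential_continuous.
split=> [p|i]; first exact: potential_continuous.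
split=> [p /(is_derive_potential e (delta_mx 0 i))[]//|].
apply: Ck_ext (IH (dker k a b (delta_mx 0 i) e)); first exact: halfspace_open.
by move=> p /partial_potential ->.
Qed.

Implicit Type xi : 'rV[R]_(n + 1).

Lemma potentialD e1 e2 p : 0 < ypart p ->
  potential (Add e1 e2) p = potential e1 p + potential e2 p.
Proof.
move=> y0; rewrite /potential -RintegralD//; [|exact: ipot|exact: ipot].
by apply: eq_Rintegral => x _; rewrite /kern /= -mulrDl -mulrDr.
Qed.

Lemma potentialZ c e p : 0 < ypart p ->
  potential (Mul (Cst _ c) e) p = c * potential e p.
Proof.
move=> y0; rewrite /potential -RintegralZl//; last exact: ipot.
by apply: eq_Rintegral => x _; rewrite /kern /=; ring.
Qed.

Lemma potential_eq0 e p : 0 < ypart p ->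
  (forall xi, 0 < xi 0 k -> ev k e xi = 0) -> potential e p = 0.
Proof.
move=> y0 e0; rewrite /potential.
under eq_Rintegral => x _.
  rewrite /kern e0 ?mulr0 ?mul0r; last by rewrite shiftE.
  over.
by rewrite /Rintegral integral0.
Qed.

(** A sum of potentials is the potential of a formal sum of multipliers; the
equation can then be checked on multipliers, pointwise. *)
Lemma potential_sum (I : Type) (r : seq I) (F : I -> multiplier) p : 0 < ypart p ->
  potential (\big[@Add R (n + 1)/@Cst R (n + 1) 0]_(i <- r) F i) p =
    \sum_(i <- r) potential (F i) p.
Proof.
move=> y0; apply: (big_morph (fun e => potential e p)).
  by move=> e1 e2; exact: potentialD.
by apply: potential_eq0.
Qed.

Lemma ev_sum (I : Type) (r : seq I) (F : I -> multiplier) xi :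
  ev k (\big[@Add R (n + 1)/@Cst R (n + 1) 0]_(i <- r) F i) xi = \sum_(i <- r) ev k (F i) xi.
Proof. exact: (big_morph (fun e => ev k e xi)). Qed.

(** The equation for c Phi, divided by Phi / 2. In the direction of the i-th
coordinate the logarithmic derivative of Phi is
L_i = a delta_ik / y - 2 b xi_i / |xi|^2, and the second derivative of Phi is Phi
times L_i^2 plus the derivative of L_i. After summation over i, the coefficient
of 1 / y^2 is (1 - a) a + a^2 - a = 0 and that of 1 / |xi|^2 is
2 b (2 b - a - n) = 0. *)
Lemma kernel_equation c xi : 0 < xi 0 k ->
  (1 - a) / xi 0 k * ev k (dker k a b (delta_mx 0 k) (Cst _ c)) xi +
  \sum_i ev k (dker k a b (delta_mx 0 i) (dker k a b (delta_mx 0 i) (Cst _ c))) xi = 0.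
Proof.
move=> y0; have r0 := sqnorm_gt0 y0.
have y0' : xi 0 k != 0 by rewrite gt_eqF.
have r0' : sqnorm xi != 0 by rewrite gt_eqF.
have dd i (w : 'rV[R]_(n + 1)) : dot (delta_mx 0 i) w = w 0 i.
  rewrite /dot (bigD1 i)//= mxE !eqxx mul1r big1 ?addr0// => j /negPf ji.
  by rewrite mxE ji andbF mul0r.
have dk i : (delta_mx 0 i : 'rV[R]_(n + 1)) 0 k = (k == i)%:R by rewrite mxE eqxx.
(* Sorted by the dependence on i: each term has an explicit sum over i. *)
have E i : ev k (dker k a b (delta_mx 0 i) (dker k a b (delta_mx 0 i) (Cst _ c))) xi =
    (k == i)%:R * (c * (a ^+ 2 - a) / xi 0 k ^+ 2)
    + (k == i)%:R * xi 0 i * (- 4 * a * b * c / (xi 0 k * sqnorm xi))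
    + xi 0 i ^+ 2 * (c * (4 * b ^+ 2 + 4 * b) / sqnorm xi ^+ 2)
    + - 2 * b * c / sqnorm xi.
  rewrite /= !dd !dk mxE !eqxx.
  by case: (k == i) => /=; field; rewrite y0' r0'.
under eq_bigr do rewrite E.
rewrite !big_split/= -!mulr_suml sumr_const card_ord.
rewrite -/(sqnorm xi).
have -> : \sum_(i < n + 1) (k == i)%:R = 1 :> R.
  rewrite (bigD1 k)//= eqxx big1 ?addr0// => j /negPf; rewrite eq_sym => -> //.
have -> : \sum_(i < n + 1) (k == i)%:R * xi 0 i = xi 0 k.
  rewrite (bigD1 k)//= eqxx mul1r big1 ?addr0// => j /negPf; rewrite eq_sym => ->.
  by rewrite mul0r.
rewrite /= !dd !dk eqxx -[- 2 *+ (n + 1)]mulr_natr natrD /b /a.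
have -> : (true%:R : R) = 1 by [].
by field; rewrite y0' r0'.
Qed.

Lemma potential_equation c p : 0 < ypart p ->
  (1 - a) / (2 * ypart p) * partial k (potential (Cst _ c)) p
    + 1 / 2 * laplacian (potential (Cst _ c)) p = 0.
Proof.
move=> y0; rewrite /laplacian partial_potential//.
under eq_bigr do rewrite partial_partial_potential//.
rewrite -potential_sum// -!potentialZ// -potentialD//.
rewrite /potential; apply: etrans (_ : \int[mu]_x (cst 0 x) = 0); last first.
  by rewrite /Rintegral integral0.
apply: eq_Rintegral => x _; rewrite /kern -(shiftE p x).
have xi0 : 0 < (p - boundary_pt x) 0 k by rewrite shiftE.
have := kernel_equation c xi0; set xi := p - boundary_pt x => Exi.
suff -> : ev k (Add (Mul (@Cst R (n + 1) ((1 - a) / (2 * xi 0 k)))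
       (dker k a b (delta_mx 0 k) (Cst _ c)))
     (Mul (@Cst R (n + 1) (1 / 2)) (\big[@Add R (n + 1)/@Cst R (n + 1) 0]_i
        dker k a b (delta_mx 0 i) (dker k a b (delta_mx 0 i) (Cst _ c))))) xi = 0.
  by rewrite mulr0 mul0r.
rewrite -[ev _ _ _]/((1 - a) / (2 * xi 0 k) * ev k (dker k a b (delta_mx 0 k) (Cst _ c)) xi
  + 1 / 2 * ev k (\big[@Add R (n + 1)/@Cst R (n + 1) 0]_i
        dker k a b (delta_mx 0 i) (dker k a b (delta_mx 0 i) (Cst _ c))) xi).
rewrite ev_sum -[RHS](mulr0 2^-1) -[in RHS]Exi.
by field; rewrite /xi shiftE gt_eqF.
Qed.

End potential.

(** * The Poisson integral and its boundary values *)
Section poisson.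
Context {R : realType} (n : nat) (s : R).
Hypothesis s0 : 0 < s.
Let b : R := n%:R / 2 + s.
Let mu := @lebesgue_rV R n.
Let c := poisson_const n s.
Implicit Types (p : 'rV[R]_(n + 1)) (x : 'rV[R]_n).

Let b0 : 0 < b. Proof. by rewrite ltr_wpDl// divr_ge0. Qed.

Let Gb0 : 0 < Gamma (s + n%:R / 2) :> R.
Proof. by rewrite addrC; exact: Gamma_gt0. Qed.

Lemma poisson_const_gt0 : 0 < c.
Proof.
by rewrite /c /poisson_const mulr_gt0 ?divr_gt0 ?invr_gt0 ?powR_gt0 ?pi_gt0 ?Gamma_gt0// addrC.
Qed.

Let kernel p x : R := poisson_kernel s (ypart p) (xpart p - x).

Lemma poisson_kernelE p x : kernel p x = c * ypart p `^ (2 * s) * weight s p x.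
Proof.
rewrite /kernel /poisson_kernel /weight sqnorm_boundary_pt mulrA /enorm sqr_sqrtr//.
exact: sqnorm_ge0.
Qed.

Lemma poisson_integralE u : poisson_integral s u = potential s u (Cst (n + 1) c).
Proof.
apply/funext => p; apply: eq_Rintegral => x _; congr (_ * _).
rewrite -/(kernel p x) poisson_kernelE /kern /base /weight /= -/b.
have -> : (p - boundary_pt x) 0 (yindex n) = ypart p.
  by rewrite mxE [X in _ + X]mxE boundary_pt_ypart subr0.
ring.
Qed.

Let kernel_ge0 p x : 0 <= kernel p x.
Proof.
have c0 := ltW poisson_const_gt0.
rewrite poisson_kernelE; apply: mulr_ge0; last by rewrite invr_ge0 powR_ge0.
by apply: mulr_ge0 => //; exact: powR_ge0.
Qed.

Let ikernel p : 0 < ypart p -> mu.-integrable setT (EFin \o kernel p).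
Proof.
move=> y0.
have := integrableZl measurableT (c * ypart p `^ (2 * s)) (integrable_weight s0 y0).
by apply: eq_integrable => // x _; rewrite /= -EFinM poisson_kernelE.
Qed.

Lemma integral_weight p : 0 < ypart p ->
  \int[mu]_x weight s p x = (c * ypart p `^ (2 * s))^-1.
Proof.
move=> y0; rewrite /Rintegral /weight.
under eq_integral do rewrite sqnorm_boundary_pt.
rewrite integral_rV_kernel//= /c /poisson_const -/mu.
have := Gamma_gt0 s0; have := powR_gt0 (n%:R / 2) (@pi_gt0 R).
have := powR_gt0 (2 * s) y0; move: Gb0 => /gt_eqF g1 /gt_eqF g2 /gt_eqF g3 /gt_eqF g4.
by field; rewrite g1 g2 g3 g4.
Qed.

Lemma integral_poisson_kernel p : 0 < ypart p -> \int[mu]_x kernel p x = 1.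
Proof.
move=> y0; under eq_Rintegral do rewrite poisson_kernelE.
rewrite RintegralZl//; last exact: integrable_weight.
rewrite integral_weight// mulfV// gt_eqF// mulr_gt0 ?powR_gt0//.
exact: poisson_const_gt0.
Qed.

(** Comparison with height 1: when |X - x| >= delta,
|X - x|^2 + 1 <= (1 + 1 / delta^2) |X - x|^2 <= (1 + 1 / delta^2) (|X - x|^2 + y^2). *)
Lemma poisson_kernel_far p x (delta : R) : 0 < delta -> 0 < ypart p ->
  delta ^+ 2 <= sqnorm (xpart p - x) ->
  kernel p x <= ypart p `^ (2 * s) * (1 + (delta ^+ 2)^-1) `^ b
    * kernel (rVpoint (xpart p) 1) x.
Proof.
move=> d0 y0 far; set A := 1 + (delta ^+ 2)^-1.
have yE : ypart (rVpoint (xpart p) 1) = 1.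
  by rewrite /ypart /rVpoint row_mxEr mxE mulr1n.
have xE : xpart (rVpoint (xpart p) 1) = xpart p by rewrite /xpart row_mxKl.
have r0 : 0 < sqnorm (xpart p - x) by apply: lt_le_trans far; rewrite exprn_gt0.
have A0 : 0 < A by rewrite addr_gt0 ?invr_gt0 ?exprn_gt0.
rewrite !poisson_kernelE /weight !sqnorm_boundary_pt yE xE powR1 expr1n mulr1.
rewrite [leRHS](_ : _ = c * ypart p `^ (2 * s) *
  (A `^ b / (sqnorm (xpart p - x) + 1) `^ b)); last by ring.
apply: ler_wpM2l.
  by apply: mulr_ge0; [exact: ltW poisson_const_gt0|exact: powR_ge0].
have r1 : 0 < sqnorm (xpart p - x) + 1 by rewrite addr_gt0.
have r2 : 0 < sqnorm (xpart p - x) + ypart p ^+ 2 by rewrite addr_gt0// exprn_gt0.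
rewrite ler_pdivlMr ?powR_gt0// mulrC ler_pdivrMr ?powR_gt0//.
rewrite -powRM ?(ltW A0) ?(ltW r2)//; apply: ge0_ler_powR;
  rewrite ?nnegrE ?mulr_ge0 ?(ltW b0) ?(ltW r1) ?(ltW A0) ?(ltW r2)//.
apply: (@le_trans _ _ (A * sqnorm (xpart p - x))); last first.
  by rewrite ler_wpM2l ?(ltW A0)// lerDl sqr_ge0.
rewrite /A mulrDl mul1r lerD2l mulrC ler_pdivlMr ?exprn_gt0//.
by rewrite mul1r.
Qed.

(** Approximate identity. The kernel multiplied by |u - u(xbar)| is bounded by eps / 2
times the kernel at p where x is close to xbar, and elsewhere by 2 M times the
bound of poisson_kernel_far; both bounds integrate to at most eps / 2 as soon as
y^(2 s) <= tau. *)
Lemma poisson_integral_boundary (u : 'rV[R]_n -> R) (M : R) (xbar : 'rV[R]_n) :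
  measurable_fun setT u -> (forall x, `|u x| <= M) ->
  {for xbar, continuous u} ->
  poisson_integral s u p @[p --> within (@halfspace R n) (nbhs (rVpoint xbar 0))]
    --> u xbar.
Proof.
move=> meas_u uM cu; apply/cvgrPdist_le => eps eps0.
have M0 : 0 <= M by exact: le_trans (normr_ge0 _) (uM 0).
have e20 : 0 < eps / 2 by rewrite divr_gt0.
have [delta /= d0 ud] : exists2 delta : R, 0 < delta &
    forall x, (forall i, `|xbar 0 i - x 0 i| < delta) -> `|u xbar - u x| <= eps / 2.
  have /cvgrPdist_le/(_ _ e20)/nbhs_ballP[delta /= d0 ud] := cu.
  exists delta => // x xd; apply: ud; split => // i j.
  by rewrite (ord1 i); exact: xd.
have d20 : 0 < delta / 2 by rewrite divr_gt0.
pose A : R := (1 + ((delta / 2) ^+ 2)^-1) `^ b.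
have A0 : 0 <= A by exact: powR_ge0.
pose tau := eps / 2 / (2 * M * A + 1).
have B0 : 0 < 2 * M * A + 1 by rewrite ltr_wpDl// !mulr_ge0.
have tau0 : 0 < tau by rewrite divr_gt0.
(* y <= eta is y^(2 s) <= tau. *)
pose eta := tau `^ (2 * s)^-1.
have eta0 : 0 < eta by rewrite powR_gt0.
have m0 : 0 < Num.min (delta / 2) eta by rewrite lt_min d20 eta0.
rewrite near_withinE; have := near_norm1 (rVpoint xbar 0) m0.
apply: filterS => p; rewrite lt_min => /andP[p1 p2] y0.
have {}y0 : 0 < ypart p by [].
have ydE : (p - rVpoint xbar 0) 0 (yindex n) = ypart p.
  by rewrite mxE [X in _ + X]mxE boundary_pt_ypart subr0.
have yeta : ypart p < eta.
  apply: le_lt_trans p2; rewrite -ydE; apply: le_trans (ler_norm _) _.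
  exact: coord_le_norm1.
have xdE i : (p - rVpoint xbar 0) 0 (lshift 1 i) = xpart p 0 i - xbar 0 i.
  by rewrite mxE [X in _ + X]mxE boundary_pt_lshift !mxE.
have xd i : `|xpart p 0 i - xbar 0 i| < delta / 2.
  by apply: le_lt_trans p1; rewrite -xdE; exact: coord_le_norm1.
have ytau : ypart p `^ (2 * s) <= tau.
  have -> : tau = eta `^ (2 * s).
    by rewrite -powRrM mulVf ?powRr1 ?(ltW tau0)// gt_eqF// mulr_gt0.
  by apply: ge0_ler_powR; rewrite ?nnegrE ?mulr_ge0 ?(ltW s0) ?(ltW y0) ?(ltW yeta) ?(ltW eta0).
pose q := rVpoint (xpart p) 1.
have q0 : 0 < ypart q by rewrite /ypart /q /rVpoint row_mxEr mxE mulr1n.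
pose B := 2 * M * (ypart p `^ (2 * s) * A).
have B'0 : 0 <= B by rewrite !mulr_ge0// powR_ge0.
have bound x : `|kernel p x * (u x - u xbar)| <=
    1 * (eps / 2 * kernel p x + B * kernel q x).
  rewrite mul1r normrM ger0_norm//.
  have [xnear|] := pselect (forall i, `|xbar 0 i - x 0 i| < delta).
    rewrite -[leLHS]addr0; apply: lerD; last exact: mulr_ge0.
    by rewrite mulrC ler_wpM2r// distrC ud.
  move=> /existsNP[i /negP]; rewrite -leNgt => xfar.
  have far : (delta / 2) ^+ 2 <= sqnorm (xpart p - x).
    apply: le_trans (sqr_coord_le_sqnorm _ i).
    rewrite -[X in _ <= X]real_normK ?num_real// lerXn2r ?nnegrE ?(ltW d20)//.
    rewrite mxE [X in _ + X]mxE.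
    have := ler_distD (xpart p 0 i) (xbar 0 i) (x 0 i).
    rewrite [`|xbar 0 i - xpart p 0 i|]distrC => tri.
    by have := xd i; lra.
  rewrite -[leLHS]add0r; apply: lerD; first by apply: mulr_ge0 => //; exact: ltW.
  have u2 : `|u x - u xbar| <= 2 * M.
    by apply: le_trans (ler_normB _ _) _; have := uM x; have := uM xbar; lra.
  apply: (@le_trans _ _ (kernel p x * (2 * M))); first by rewrite ler_wpM2l.
  have := poisson_kernel_far d20 y0 far; rewrite -/A -/q => far'.
  by rewrite mulrC /B -mulrA; apply: ler_wpM2l => //; exact: mulr_ge0.
have ig : mu.-integrable setT
    (EFin \o (fun x => eps / 2 * kernel p x + B * kernel q x)).
  have := integrableD measurableT (integrableZl measurableT (eps / 2) (ikernel y0))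
    (integrableZl measurableT B (ikernel q0)).
  by apply: eq_integrable.
have mk : measurable_fun setT (kernel p).
  by have /integrableP[/measurable_EFinP] := ikernel y0.
have iku : mu.-integrable setT (EFin \o (fun x => kernel p x * u x)).
  apply: (@dominated_integrable _ _ _ _ _ (kernel p) M).
  - exact: measurable_funM.
  - exact: ikernel.
  - by move=> x; rewrite normrM ger0_norm// mulrC ler_wpM2r.
have iku' : mu.-integrable setT (EFin \o (fun x => u xbar * kernel p x)).
  by have := integrableZl measurableT (u xbar) (ikernel y0).
have -> : u xbar = \int[mu]_x (u xbar * kernel p x).
  by rewrite RintegralZl ?integral_poisson_kernel ?mulr1//; exact: ikernel.
rewrite distrC /poisson_integral -RintegralB//.
rewrite (@eq_Rintegral _ _ _ _ _ (fun x => kernel p x * (u x - u xbar))); last first.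
  by move=> x _; rewrite mulrBr [u xbar * _]mulrC.
apply: le_trans (norm_Rintegral_dominated _ ig bound) _.
  by apply: measurable_funM => //; exact: measurable_funB.
rewrite mul1r RintegralD//; last 2 first.
- by have := integrableZl measurableT (eps / 2) (ikernel y0).
- by have := integrableZl measurableT B (ikernel q0).
rewrite RintegralZl//; last exact: ikernel.
rewrite RintegralZl//; last exact: ikernel.
rewrite !integral_poisson_kernel// !mulr1.
have : B <= eps / 2; last by lra.
rewrite /B [ypart p `^ _ * A]mulrC mulrA.
apply: (@le_trans _ _ ((2 * M * A + 1) * tau)).
  by rewrite ler_pM ?powR_ge0 ?mulr_ge0// lerDl.
by rewrite /tau mulrC divfK// gt_eqF.
Qed.

End poisson.

Theorem proposition3p2 (R : realType) (n : nat) (hn : (1 <= n)%N)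
    (s : R) (hs0 : 0 < s) (hs1 : s < 1)
    (u : 'rV[R]_n -> R) (hu : Ck 2 setT u)
    (hb : exists M : R, forall x : 'rV[R]_n, `|u x| <= M) :
  dirichlet_solution s u (poisson_integral s u).
Proof.
have [M uM] := hb; have [cu _] := hu.
have meas_u : measurable_fun setT u.
  by apply: continuous_rV_measurable => x; exact: cu.
split.
- by rewrite poisson_integralE; apply: (Ck_potential hs0 meas_u uM).
- by move=> p p0; rewrite poisson_integralE; exact: (potential_equation hs0 meas_u uM).
- by move=> xbar; apply: (poisson_integral_boundary hs0 meas_u uM); exact: cu.
Qed.
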